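(* Let $g\in\mathcal F_{\beta+k}(L)$ with $\beta>1$ and $k\ge0$ an integer, let $f=\partial_j^kg$, and let $h>0$. For every $x_t$ with values in $\mathbb R^d$ and every $l\in\{1,\dots,d\}$, the gradient estimator $\tilde g_t=(\tilde g_{t,1},\dots,\tilde g_{t,d})$ defined in the context satisfies $$\bigl|\mathbb E[\tilde g_{t,l}\mid x_t]-\partial_lf(x_t)\bigr|\le C_{\mathrm{bias}}\,h^{\beta-1},$$ where $$C_{\mathrm{bias}}:=L\,\bigl(\mathbb E[K_k(U)^2]\bigr)^{1/2}\bigl(\mathbb E[K_1(V)^2]\bigr)^{1/2}$$ with $U,V$ uniform on $[-1/2,1/2]$. Consequently, $$\bigl\|\mathbb E[\tilde g_t\mid x_t]-\nabla f(x_t)\bigr\|^2\le d\,C_{\mathrm{bias}}^2\,h^{2(\beta-1)}.$$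
   Context: **Notation.** $\|\cdot\|$ is the Euclidean norm on $\mathbb R^d$. A coordinate $j\in\{1,\dots,d\}$ is fixed; $e_l$ is the $l$-th canonical basis vector; $\partial_j^k$ is the $k$-th order partial derivative in the $j$-th coordinate, with $\partial_j^0g:=g$. $\lfloor\beta\rfloor$ denotes the largest integer strictly less than $\beta$. **Hölder class.** For $\beta,L>0$ and $\ell=\lfloor\beta\rfloor$, $\mathcal F_\beta(L)$ is the set of functions $\phi:\mathbb R^d\to\mathbb R$ that are $\ell$ times continuously differentiable and satisfy $\bigl|\phi(z)-\sum_{|m|\le\ell}\frac1{m!}D^m\phi(x)(z-x)^m\bigr|\le L\|z-x\|^\beta$ for all $x,z\in\mathbb R^d$ ($m$ multi-index). **Kernels.** Let $\ell_*:=\lfloor\beta+k\rfloor$. Two fixed bounded kernels $K_k,K_1:[-1/2,1/2]\to\mathbb R$ are given (chosen separately, also when $k=1$) such that $\int u^aK_k(u)\,du=0$ for $a\in\{0,\dots,\ell_*\}\setminus\{k\}$ and $\int u^kK_k(u)\,du=k!$; and $\int v^bK_1(v)\,dv=0$ for $b=0$ and for all odd $b$ with $3\le b\le\ell_*$, and $\int vK_1(v)\,dv=1$. **Oracle and gradient estimator.** Given the current point $x_t$ (a given point of $\mathbb R^d$, or a bounded random vector such as the iterate of a projected algorithm built from randomization variables and noises of earlier steps), for each $l\in\{1,\dots,d\}$ one observes $$y^{\pm}_{t,l}=g(x_t+hU_{t,l}e_j\pm hV_{t,l}e_l)+\varepsilon^{\pm}_{t,l},$$ where the $U_{t,l},V_{t,l}$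 are i.i.d. uniform on $[-1/2,1/2]$, $\mathbb E[(\varepsilon^\pm_{t,l})^2]\le\sigma^2<\infty$, and the randomization variables $(U_{t,l},V_{t,l})_{l}$ of step $t$ are independent of the pair formed by $x_t$ and the noises $(\varepsilon^\pm_{t,l})_{l}$. (In the algorithm this holds because all randomization variables over all steps are i.i.d. and jointly independent of all the noises, and $x_t$ depends only on earlier steps.) The noises are not assumed centered or independent of each other. The estimator is $$\tilde g_{t,l}:=\frac{K_k(U_{t,l})K_1(V_{t,l})}{2h^{k+1}}\bigl(y^+_{t,l}-y^-_{t,l}\bigr),\qquad l=1,\dots,d .$$ When $x_t$ is random the inequalities hold almost surely; when it is a fixed point, $\mathbb E[\cdot\mid x_t]$ is the expectation. *)

(* Defs.v *)
From HB Require Import structures.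
From mathcomp Require Import all_boot all_order all_algebra.
From mathcomp Require Import all_classical all_reals all_analysis.

Set Implicit Arguments.
Unset Strict Implicit.
Unset Printing Implicit Defensive.

Import Order.TTheory GRing.Theory Num.Theory.
Import numFieldNormedType.Exports.

Local Open Scope classical_set_scope.
Local Open Scope ring_scope.

(* The library norm on ['rV[R]_d] is the sup norm; it induces the same topology
   but is not the norm of the Hölder condition. *)
Definition enorm (R : realType) (d : nat) (x : 'rV[R]_d) : R :=
  Num.sqrt (\sum_(i < d) x 0 i ^+ 2).

Definition basis_vec (R : realType) (d : nat) (l : 'I_d) : 'rV[R]_d :=
  delta_mx 0 l.

Definition partial (R : realType) (d : nat) (l : 'I_d)
    (f : 'rV[R]_d -> R) : 'rV[R]_d -> R :=
  fun x => 'D_(basis_vec R l) f x.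

Definition gradient (R : realType) (d : nat) (f : 'rV[R]_d -> R)
    (x : 'rV[R]_d) : 'rV[R]_d :=
  \row_(l < d) partial l f x.

(* [foldr partial f [:: i_1; ...; i_r]] is the mixed partial derivative
   [d_{i_1} (... (d_{i_r} f))]; all of them up to order [n] must exist and be
   continuous. *)
Definition C_class (R : realType) (d : nat) (n : nat)
    (f : 'rV[R]_d -> R) : Prop :=
  (forall (s : seq 'I_d) (i : 'I_d) (x : 'rV[R]_d), (size s < n)%N ->
     derivable (foldr (@partial R d) f s) x (basis_vec R i)) /\
  (forall s : seq 'I_d, (size s <= n)%N ->
     continuous (foldr (@partial R d) f s)).

(* Largest integer strictly less than [b], for [b > 0]; see [strict_floorP]. *)
Definition strict_floor (R : realType) (b : R) : nat := `|Num.ceil b|%N.-1.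

Lemma strict_floorP (R : realType) (b : R) : 0 < b ->
  (strict_floor b)%:R < b /\
  forall n : int, n%:~R < b -> (n <= (strict_floor b)%:Z)%R.
Proof.
move=> b0; have c0 : 0 < Num.ceil b by rewrite ceil_gt0.
have e : (strict_floor b)%:Z = Num.ceil b - 1.
  by rewrite /strict_floor; case: (Num.ceil b) c0 => [[|n]|n] //= _; rewrite intS addrC addKr.
split.
  by rewrite -[_%:R]/((strict_floor b)%:Z%:~R) e; have := ceilB1_lt b.
by move=> n nb; rewrite e lerBrDr lezD1 -(ltr_int R) (lt_le_trans nb)// ceil_ge.
Qed.

(* A multi-index [m] of order [<= n] has all its entries [<= n], so it is an
   element of [{ffun 'I_d -> 'I_n.+1}]. *)
Definition multi_deriv (R : realType) (d n : nat)
    (m : {ffun 'I_d -> 'I_n.+1}) (f : 'rV[R]_d -> R) : 'rV[R]_d -> R :=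
  foldr (fun i phi => iter (m i) (partial i) phi) f (enum 'I_d).

Definition taylor (R : realType) (d n : nat) (f : 'rV[R]_d -> R)
    (x z : 'rV[R]_d) : R :=
  \sum_(m : {ffun 'I_d -> 'I_n.+1} | (\sum_(i < d) m i <= n)%N)
    (\prod_(i < d) (m i)`!%:R)^-1 * multi_deriv m f x
      * \prod_(i < d) (z - x) 0 i ^+ m i.

Definition holder_class (R : realType) (d : nat) (b L : R)
    (f : 'rV[R]_d -> R) : Prop :=
  C_class (strict_floor b) f /\
  forall x z : 'rV[R]_d,
    `|f z - taylor (strict_floor b) f x z| <= L * enorm (z - x) `^ b.

Definition half_itv (R : realType) : set R := `[- 2^-1, 2^-1].
Arguments half_itv : clear implicits.

Lemma half_lt (R : realType) : - 2^-1 < 2^-1 :> R.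
Proof. by rewrite gtrN// invr_gt0. Qed.

(* A kernel on [[-1/2, 1/2]] is represented by a Borel function on the line
   (e.g. its extension by zero); its values off the interval are irrelevant. *)
Definition bounded_kernel (R : realType) (K : R -> R) : Prop :=
  measurable_fun setT K /\
  exists M : R, forall u, half_itv R u -> `|K u| <= M.

Definition kernel_moment (R : realType) (K : R -> R) (a : nat) : R :=
  \int[lebesgue_measure]_(u in half_itv R) (u ^+ a * K u).

Definition deriv_kernel (R : realType) (k n : nat) (K : R -> R) : Prop :=
  [/\ bounded_kernel K,
      forall a : nat, (a <= n)%N -> a != k -> kernel_moment K a = 0
    & kernel_moment K k = k`!%:R].

Definition grad_kernel (R : realType) (n : nat) (K : R -> R) : Prop :=
  [/\ bounded_kernel K,
      kernel_moment K 0 = 0,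
      forall b : nat, odd b -> (3 <= b <= n)%N -> kernel_moment K b = 0
    & kernel_moment K 1 = 1].

Definition C_bias (R : realType) (L : R) (Kk K1 : R -> R) : R :=
  L * Num.sqrt (fine 'E_(uniform_prob (half_lt R))[fun u => Kk u ^+ 2])
    * Num.sqrt (fine 'E_(uniform_prob (half_lt R))[fun v => K1 v ^+ 2]).

Definition sigma_of (dO : measure_display) (Omega : measurableType dO)
    (R : realType) (I : Type) (W : I -> Omega -> R) : set (set Omega) :=
  <<s \bigcup_i preimage_set_system setT (W i) measurable >>.

Definition mutually_independent (dO : measure_display)
    (Omega : measurableType dO) (R : realType) (P : probability Omega R)
    (I : finType) (W : I -> Omega -> R) : Prop :=
  forall (J : {set I}) (B : I -> set R), (forall i, measurable (B i)) ->
    P (\bigcap_(i in [set` J]) (W i @^-1` B i))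
    = (\prod_(i in J) P (W i @^-1` B i))%E.

Definition independent_families (dO : measure_display)
    (Omega : measurableType dO) (R : realType) (P : probability Omega R)
    (I J : Type) (W : I -> Omega -> R) (W' : J -> Omega -> R) : Prop :=
  forall A B, sigma_of W A -> sigma_of W' B ->
    P (A `&` B) = (P A * P B)%E.

(* [Z] is a version of the conditional expectation of [Y] given the
   sub-sigma-algebra [G]. *)
Definition is_condexp (dO : measure_display) (Omega : measurableType dO)
    (R : realType) (P : probability Omega R) (G : set (set Omega))
    (Y Z : Omega -> R) : Prop :=
  [/\ P.-integrable setT (EFin \o Y),
      P.-integrable setT (EFin \o Z),
      forall B, measurable B -> G (Z @^-1` B)
    & forall A, G A ->
        (\int[P]_(w in A) (Z w)%:E = \int[P]_(w in A) (Y w)%:E)%E].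

Definition rand_vec (Omega : Type) (R : realType) (d : nat)
    (X : 'I_d -> Omega -> R) : Omega -> 'rV[R]_d :=
  fun w => \row_(i < d) X i w.

Definition cat_fam (I J T : Type) (F : I -> T) (G : J -> T) : I + J -> T :=
  fun i => match i with inl a => F a | inr b => G b end.

Definition obs_plus (Omega : Type) (R : realType) (d : nat) (j : 'I_d)
    (h : R) (g : 'rV[R]_d -> R) (X U V epsp : 'I_d -> Omega -> R)
    (l : 'I_d) (w : Omega) : R :=
  g (rand_vec X w + (h * U l w) *: basis_vec R j + (h * V l w) *: basis_vec R l)
  + epsp l w.

Definition obs_minus (Omega : Type) (R : realType) (d : nat) (j : 'I_d)
    (h : R) (g : 'rV[R]_d -> R) (X U V epsm : 'I_d -> Omega -> R)
    (l : 'I_d) (w : Omega) : R :=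
  g (rand_vec X w + (h * U l w) *: basis_vec R j - (h * V l w) *: basis_vec R l)
  + epsm l w.

Definition grad_est (Omega : Type) (R : realType) (d : nat) (j : 'I_d)
    (k : nat) (h : R) (g : 'rV[R]_d -> R) (Kk K1 : R -> R)
    (X U V epsp epsm : 'I_d -> Omega -> R) (l : 'I_d) (w : Omega) : R :=
  Kk (U l w) * K1 (V l w) / (2 * h ^+ k.+1)
  * (obs_plus j h g X U V epsp l w - obs_minus j h g X U V epsm l w).

(* [X] is the vector of coordinates of the current point, an almost surely
   bounded random vector; a fixed point is the case of constant [X].  The
   noises need not be centered, nor independent of each other or of [X]. *)
Definition oracle_model (dO : measure_display) (Omega : measurableType dO)
    (R : realType) (P : probability Omega R) (d : nat) (sigma : R)
    (X U V epsp epsm : 'I_d -> {RV P >-> R}) : Prop :=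
  [/\ exists M : R, {ae P, forall w, enorm (rand_vec X w) <= M},
      forall l A, measurable A ->
        distribution P (U l) A = uniform_prob (half_lt R) A /\
        distribution P (V l) A = uniform_prob (half_lt R) A,
      mutually_independent P (cat_fam U V),
      forall l, ('E_P[(fun w => epsp l w ^+ 2)%R] <= (sigma ^+ 2)%R%:E)%E /\
                ('E_P[(fun w => epsm l w ^+ 2)%R] <= (sigma ^+ 2)%R%:E)%E
    & independent_families P (cat_fam U V) (cat_fam X (cat_fam epsp epsm))].

(* Main.v *)
(* Expand g at x by Taylor's formula.  Against the product kernel K_k(u) K_1(v)
   the moment conditions annihilate every monomial of the symmetric difference
   g(x + h u e_j + h v e_l) - g(x + h u e_j - h v e_l) except the one with
   multi-index m* = k e_j + e_l, whose coefficient is d_l d_j^k g(x) up to the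
   order of differentiation (Schwarz).  Since |u| , |v| <= 1/2 the displacement
   has norm at most h, so the Hölder remainder contributes at most
   L h^(beta - 1) E|K_k| E|K_1|, which Cauchy-Schwarz turns into C_bias.

   For a random point, let xi be the pair of x_t and the noises.  The joint law
   of (omega, (U, V)), with omega seen through sigma(xi), is a product measure,
   so by Fubini the conditional expectation given xi is obtained by integrating
   over (u, v) with omega frozen; the noises drop out because K_1 has mean zero,
   and what remains is a function of x_t alone, hence also the conditional
   expectation given x_t. *)

Require Import Defs.
From HB Require Import structures.
From mathcomp Require Import all_boot all_order all_algebra.
From mathcomp Require Import all_classical all_reals all_analysis.
From mathcomp Require Import measurable_realfun.
From mathcomp Require Import ring lra.

Import Order.TTheory GRing.Theory Num.Theory.
Import numFieldNormedType.Exports.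

Local Open Scope classical_set_scope.
Local Open Scope ring_scope.

(** * Schwarz's theorem *)

Section mixed_partials.
Context {R : realType} {V : normedModType R}.
Implicit Types (phi : V -> R) (x a b : V).

Lemma is_derive_line phi x a (t : R) : derivable phi (x + t *: a) a ->
  is_derive t 1 (fun s => phi (x + s *: a)) ('D_a phi (x + t *: a)).
Proof.
move=> dphi.
have E : (fun h : R => h^-1 *:
      (((fun s => phi (x + s *: a)) \o shift t) (h *: 1) - phi (x + t *: a)))
    = (fun h : R => h^-1 *:
      ((phi \o shift (x + t *: a)) (h *: a) - phi (x + t *: a))).
  apply/funext => h /=; congr (_ *: (phi _ - _)).
  by rewrite [h%:A]mulr1 scalerDl addrCA addrA.
by split; [rewrite /derivable E|rewrite /derive E].
Qed.

(** Two mean value theorems: along [a] for the increment of [phi] in direction [b], then along [b]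
    for ['D_a phi]. The intermediate point stays in the parallelogram spanned by [s *: a] and
    [s *: b]. *)
Lemma mean_value_square phi x a b (s : R) : 0 < s ->
  (forall y, derivable phi y a) -> (forall y, derivable ('D_a phi) y b) ->
  exists t1 t2 : R, [/\ 0 <= t1 <= s, 0 <= t2 <= s &
    phi (x + s *: a + s *: b) - phi (x + s *: a) - phi (x + s *: b) + phi x
    = 'D_b ('D_a phi) (x + t1 *: a + t2 *: b) * s * s].
Proof.
move=> s0 da dab.
pose psi := fun t : R => phi ((x + s *: b) + t *: a) - phi (x + t *: a).
have dpsi (t : R) : is_derive t 1 psi
    ('D_a phi ((x + s *: b) + t *: a) - 'D_a phi (x + t *: a)).
  by apply: is_deriveB; exact: is_derive_line.
have [|t1 t1s psiE] := MVT_segment (ltW s0) (fun t _ => dpsi t).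
  apply: derivable_within_continuous => t _.
  by have [] := dpsi t.
pose chi := fun t : R => 'D_a phi ((x + t1 *: a) + t *: b).
have dchi (t : R) : is_derive t 1 chi ('D_b ('D_a phi) ((x + t1 *: a) + t *: b)).
  exact: is_derive_line.
have [|t2 t2s chiE] := MVT_segment (ltW s0) (fun t _ => dchi t).
  apply: derivable_within_continuous => t _.
  by have [] := dchi t.
exists t1, t2; split; [by rewrite in_itv in t1s|by rewrite in_itv in t2s|].
move: psiE chiE; rewrite /psi /chi !scale0r !addr0 !subr0.
rewrite (addrAC x (s *: b)) (addrAC x (s *: b)) => psiE chiE.
rewrite -chiE -psiE; ring.
Qed.

(** The second difference is symmetric in [a] and [b], so [mean_value_square] gives, arbitrarily
    close to [x], points where the two mixed derivatives take the same value. Continuity at [x] then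
    forces equality there; otherwise half the gap [D] serves as tolerance. *)
Lemma mixed_partialsC phi x a b :
  (forall y, derivable phi y a) -> (forall y, derivable phi y b) ->
  (forall y, derivable ('D_a phi) y b) -> (forall y, derivable ('D_b phi) y a) ->
  {for x, continuous ('D_b ('D_a phi))} ->
  {for x, continuous ('D_a ('D_b phi))} ->
  'D_b ('D_a phi) x = 'D_a ('D_b phi) x.
Proof.
move=> da db dab dba cab cba.
apply/eqP; rewrite -subr_eq0 -normr_eq0; apply/negPn/negP => ne0.
set D := `|_ - _| in ne0.
have D0 : 0 < D by rewrite lt_def ne0 normr_ge0.
pose e := D / 2.
have e0 : 0 < e by rewrite divr_gt0.
have /cvgrPdist_lt /(_ e e0) n1 := cab.
have /cvgrPdist_lt /(_ e e0) n2 := cba.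
have [r /= r0 rP] := (iffLR (nbhs_ballP _ _) (filterI n1 n2)).
(* With this side, every point [x + t1 *: a + t2 *: b] is at distance at most [r / 2] from [x]. The
   added [1] keeps the denominator positive when [a] and [b] both vanish. *)
pose s := r / (2 * (`|a| + `|b| + 1)).
have ab0 : 0 < `|a| + `|b| + 1 by rewrite ltr_wpDl// addr_ge0.
have s0 : 0 < s by rewrite divr_gt0// mulr_gt0.
have small (t1 t2 : R) : 0 <= t1 <= s -> 0 <= t2 <= s ->
    ball x r (x + t1 *: a + t2 *: b).
  move=> /andP[t10 t1s] /andP[t20 t2s]; rewrite -ball_normE /= -addrA opprD.
  rewrite addrA subrr sub0r normrN.
  apply: (le_lt_trans (ler_normD _ _)); rewrite !normrZ !ger0_norm//.
  apply: (@le_lt_trans _ _ (s * (`|a| + `|b| + 1))).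
    rewrite mulrDr mulr1 mulrDr ler_wpDr ?(ltW s0)//.
    by rewrite lerD// ler_wpM2r.
  by rewrite /s invfM mulrA divfK ?gt_eqF// ltr_pdivrMr// ltr_pMr// ltr1n.
have [t1 [t2 [t1s t2s E1]]] := mean_value_square _ x _ _ _ s0 da dab.
have [u1 [u2 [u1s u2s E2]]] := mean_value_square _ x _ _ _ s0 db dba.
have [B1 _] := rP _ (small _ _ t1s t2s).
have [_] := rP _ (small _ _ u2s u1s).
rewrite (addrAC x) => B2.
have E : 'D_b ('D_a phi) (x + t1 *: a + t2 *: b)
    = 'D_a ('D_b phi) (x + u1 *: b + u2 *: a).
  apply: (mulIf (lt0r_neq0 s0)); apply: (mulIf (lt0r_neq0 s0)).
  apply: etrans (esym E1) _; apply: etrans _ E2.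
  by rewrite (addrAC x (s *: a)) (addrAC (phi (x + s *: b + s *: a))).
have eD : D = e + e by rewrite /e -splitr.
suff : D < e + e by rewrite -eD ltxx.
rewrite E in B1; move: B1 B2; rewrite /D; clearbody e; clear.
move: ('D_b ('D_a phi) x) ('D_a ('D_b phi) x) ('D_a ('D_b phi) _) => p q r'.
move=> B1 B2; rewrite (_ : p - q = (p - r') - (q - r')); last by ring.
by apply: (le_lt_trans (ler_normB _ _)); rewrite ltrD.
Qed.

End mixed_partials.

(** * Commuting partial derivatives of functions of class C^n *)

Section class_C.
Context {R : realType} {d : nat}.
Implicit Types (f : 'rV[R]_d -> R) (i j l : 'I_d) (n k : nat).

Lemma C_class_le f n m : (m <= n)%N -> C_class n f -> C_class m f.
Proof.
move=> mn [df cf]; split=> [s i x sm|s sm].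
  by apply: df; exact: leq_trans mn.
by apply: cf; exact: leq_trans mn.
Qed.

Lemma C_class_partial f n i : C_class n.+1 f -> C_class n (partial i f).
Proof.
move=> [df cf]; split=> [s l x sn|s sn].
  by have := df (rcons s i) l x; rewrite foldr_rcons size_rcons; apply.
by have := cf (rcons s i); rewrite foldr_rcons size_rcons; apply.
Qed.

Lemma partialC f i l : C_class 2 f ->
  partial i (partial l f) = partial l (partial i f).
Proof.
move=> [df cf]; apply/funext => x; rewrite /partial.
apply: mixed_partialsC.
- by move=> y; exact: (df [::]).
- by move=> y; exact: (df [::]).
- by move=> y; exact: (df [:: l]).
- by move=> y; exact: (df [:: i]).
- exact: (cf [:: i; l]).
- exact: (cf [:: l; i]).
Qed.

Lemma iter_partialC f j l k : C_class k.+1 f ->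
  iter k (partial j) (partial l f) = partial l (iter k (partial j) f).
Proof.
elim: k f => // k IH f Cf.
rewrite !iterSr partialC; last exact: C_class_le Cf.
by apply: IH; exact: C_class_partial.
Qed.

(** The multi-index k e_j + e_l, the only one to survive integration against the kernels. For
    [j = l] the same formula yields (k+1) e_j. *)
Definition midx j k l i : nat := (k * (i == j) + (i == l))%N.

(** If [l] comes after [j] in the list, its derivative is taken first and has to be pulled out
    through the [k] derivatives in [j] by [iter_partialC]. The membership bits record which of the
    two coordinates the list contains, so that induction on the list goes through. *)
Lemma foldr_midx f j k l (s : seq 'I_d) : C_class k.+1 f -> uniq s ->
  foldr (fun i phi => iter (midx j k l i) (partial i) phi) f s =
  iter (l \in s) (partial l) (iter (k * (j \in s)) (partial j) f).
Proof.
move=> Cf; elim: s => [|i s IH] /=; first by rewrite muln0.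
move=> /andP[si us]; rewrite {}IH// /midx !inE.
rewrite (eq_sym j i) (eq_sym l i).
have [ij|ij] := eqVneq i j; have [il|il] := eqVneq i l;
  rewrite /= ?muln1 ?muln0 ?addn0 //.
- by rewrite -ij -il (negbTE si) muln0 /= addn1.
- rewrite -ij (negbTE si) muln0 /=; case: (l \in s) => //=.
  exact: iter_partialC.
- by rewrite -il (negbTE si).
Qed.

End class_C.

(** * Kernel moments of the Taylor polynomial *)

Section taylor_moments.
Context {R : realType} {d : nat}.
Variables (j l : 'I_d) (k n : nat) (M N : nat -> R).
(* [mom p r]: the mean of [p u v] against the product kernel is [r]. *)
Variable mom : (R -> R -> R) -> R -> Prop.
Hypotheses (mom0 : mom (fun _ _ => 0) 0)
  (momD : forall p q a b, mom p a -> mom q b ->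
     mom (fun u v => p u v + q u v) (a + b))
  (momZ : forall c p a, mom p a -> mom (fun u v => c * p u v) (c * a))
  (mom_mono : forall a b, mom (fun u v => u ^+ a * v ^+ b) (M a * N b)).
Hypotheses (kn : (k < n)%N)
  (M0 : forall a, (a <= n)%N -> a != k -> M a = 0) (Mk : M k = k`!%:R)
  (N0 : N 0%N = 0) (N1 : N 1%N = 1)
  (Nodd : forall b, odd b -> (3 <= b <= n)%N -> N b = 0).

Lemma mom_sum (I : Type) (r : seq I) (P : pred I) (p : I -> R -> R -> R)
    (a : I -> R) : (forall i, P i -> mom (p i) (a i)) ->
  mom (fun u v => \sum_(i <- r | P i) p i u v) (\sum_(i <- r | P i) a i).
Proof.
move=> pa; elim: r => [|i r IH].
  rewrite big_nil (_ : (fun _ _ => _) = fun _ _ => 0)//.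
  by apply/funext => u; apply/funext => v; rewrite big_nil.
rewrite big_cons (_ : (fun _ _ => _) = fun u v =>
  if P i then p i u v + \sum_(i <- r | P i) p i u v
  else \sum_(i <- r | P i) p i u v); last first.
  by apply/funext => u; apply/funext => v; rewrite big_cons.
by case: ifPn => // Pi; apply: momD => //; exact: pa.
Qed.

(** The factor [1 - (-1) ^+ b] comes from the symmetric difference: it vanishes for even [b] and
    equals [2] for odd [b]. Among the odd powers only [b = 1] escapes [Nodd]. *)
Lemma momentsE a b : (a <= n)%N -> (b <= n)%N ->
  (1 - (-1) ^+ b) * (M a * N b) =
  if (a == k) && (b == 1%N) then 2 * k`!%:R else 0.
Proof.
move=> an bn; have [->|ak] /= := eqVneq a k; last by rewrite M0// mul0r mulr0.
rewrite Mk; case: b bn => [|[|[|b]]] bn /=.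
- by rewrite N0 !mulr0.
- by rewrite N1 expr1 opprK mulr1.
- by rewrite sqrrN expr1n subrr mul0r.
- case/boolP: (odd b) => ob; last by rewrite Nodd ?mulr0//= negbK.
  by rewrite -[(-1) ^+ b.+3]signr_odd /= ob subrr mul0r.
Qed.

(** Coordinates of the displacement u e_j + s v e_l, with [h] factored out; the two query points are
    [s = 1] and [s = -1]. *)
Definition displ (s u v : R) (i : 'I_d) : R := u * (i == j)%:R + s * v * (i == l)%:R.

(** If [j = l] the displacement is (u + s v) e_j and the binomial theorem produces the monomials in
    [u] and [v]; if [j != l] the product is already a single monomial. Either way [momentsE] decides
    which terms remain. *)
Lemma mom_displ (m : {ffun 'I_d -> 'I_n.+1}) : (\sum_(i < d) m i <= n)%N ->
  mom (fun u v => \prod_(i < d) displ 1 u v i ^+ m i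
                  - \prod_(i < d) displ (-1) u v i ^+ m i)
    (if [forall i, m i == midx j k l i :> nat]
     then 2 * \prod_(i < d) (m i)`!%:R else 0).
Proof.
move=> mn; have [jl|jl] := eqVneq j l.
(* [z] collects the coordinates that are not displaced. Since [0 ^+ 0 = 1], it is [1] if [m]
   vanishes at all of them and [0] otherwise. *)
- pose z : R := \prod_(i < d | i != j) 0 ^+ m i.
  have E s u v : \prod_(i < d) displ s u v i ^+ m i = z * (u + s * v) ^+ m j.
    rewrite (bigD1 j)//= mulrC /displ -jl eqxx !mulr1; congr (_ * _).
    by apply: eq_bigr => i ij; rewrite (negbTE ij) !mulr0 addr0.
  rewrite [X in mom X](_ : _ = fun u v => \sum_(i < (m j).+1)
      (z * (1 - (-1) ^+ i) * 'C(m j, i)%:R) * (u ^+ (m j - i) * v ^+ i)); last first.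
    apply/funext => u; apply/funext => v; rewrite !E -mulrBr !exprDn -sumrB.
    rewrite mulr_sumr; apply: eq_bigr => i _.
    rewrite mul1r exprMn -mulrnBl -[_ *+ _]mulr_natr.
    by move: (u ^+ _) (v ^+ _) ((-1) ^+ _) ('C(_, _)%:R) => *; ring.
  rewrite [X in mom _ X](_ : _ = \sum_(i < (m j).+1)
      (z * (1 - (-1) ^+ i) * 'C(m j, i)%:R) * (M (m j - i) * N i)).
    by apply: mom_sum => i _; exact: momZ.
  have mjn : (m j <= n)%N by rewrite -ltnS ltn_ord.
  transitivity (z * \sum_(i < (m j).+1) 'C(m j, i)%:R *
      (if (m j - i == k)%N && (i == 1%N :> nat) then 2 * k`!%:R else 0)); last first.
    rewrite mulr_sumr; apply: eq_bigr => i _; rewrite -momentsE.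
    + by move: ((-1) ^+ _) ('C(_, _)%:R) (M _) (N _) => *; ring.
    + exact: leq_trans (leq_subr _ _) mjn.
    + by apply: leq_trans mjn; rewrite -ltnS.
  case: ifPn => [/forallP mE|/forallPn mE].
    have mj : m j = k.+1 :> nat by rewrite (eqP (mE j)) /midx jl eqxx muln1 addn1.
    have mi i : i != j -> m i = 0%N :> nat.
      by move=> ij; rewrite (eqP (mE i)) /midx -jl (negbTE ij) muln0.
    have -> : z = 1 by rewrite /z big1// => i /mi ->.
    rewrite (bigD1 j)//= [X in _ * (_ * X)]big1 ?mulr1; last by move=> i /mi ->.
    (* Only the binomial term of index [1] survives; its coefficient k+1 turns k! into (k+1)!, the
       factorial of [m j]. *)
    have lt1 : (1 < (m j).+1)%N by rewrite mj.
    rewrite (bigD1 (Ordinal lt1))//= big1 ?addr0.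
      rewrite mj subn1 /= eqxx /= bin1 factS natrM; ring.
    move=> i i1; rewrite (negbTE (_ : i != 1%N :> nat)) ?andbF ?mulr0//.
  case: mE => i mi; have [ij|ij] := eqVneq i j.
    rewrite big1 ?mulr0// => b _.
    case: ifPn => [/andP[/eqP mb /eqP b1]|]; last by rewrite mulr0.
    (* Subtraction is truncated: [m j - 1 = k] gives [m j = k.+1] because the index [b = 1] is in
       range, which makes [m j] positive. *)
    case/negP: mi; rewrite ij /midx jl eqxx -jl muln1 addn1 -mb b1 subn1 prednK//.
    by rewrite -ltnS -b1 ltn_ord.
  rewrite /z (bigD1 i)//= expr0n (negbTE (_ : m i != 0%N :> nat)) ?mul0r//.
  by apply: contraNneq mi => ->; rewrite /midx -jl (negbTE ij) muln0.
- pose z : R := \prod_(i < d | (i != j) && (i != l)) 0 ^+ m i.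
  have lj : l != j by rewrite eq_sym.
  have E s u v : \prod_(i < d) displ s u v i ^+ m i = z * (u ^+ m j * (s * v) ^+ m l).
    rewrite (bigD1 j)//= (bigD1 l)//= mulrA mulrC /displ !eqxx (negbTE jl) (negbTE lj).
    rewrite !mulr0 !mulr1 addr0 add0r; congr (_ * _).
    by apply: eq_bigr => i /andP[ij il]; rewrite (negbTE ij) (negbTE il) !mulr0 addr0.
  rewrite [X in mom X](_ : _ = fun u v =>
      (z * (1 - (-1) ^+ m l)) * (u ^+ m j * v ^+ m l)); last first.
    apply/funext => u; apply/funext => v; rewrite !E mul1r exprMn.
    by move: (u ^+ _) (v ^+ _) ((-1) ^+ _) => *; ring.
  rewrite [X in mom _ X](_ : _ = (z * (1 - (-1) ^+ m l)) * (M (m j) * N (m l))).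
    by apply: momZ.
  rewrite -mulrA momentsE ?leq_ord//.
  case: ifPn => [/forallP mE|/forallPn mE].
    have mj : m j = k :> nat by rewrite (eqP (mE j)) /midx (negbTE jl) eqxx muln1 addn0.
    have ml : m l = 1%N :> nat by rewrite (eqP (mE l)) /midx (negbTE lj) eqxx muln0.
    have mi i : (i != j) && (i != l) -> m i = 0%N :> nat.
      by move=> /andP[ij il]; rewrite (eqP (mE i)) /midx (negbTE ij) (negbTE il) muln0.
    have -> : z = 1 by rewrite /z big1// => i /mi ->.
    rewrite (bigD1 j)//= (bigD1 l)//= mj ml !eqxx.
    by rewrite [X in _ * (_ * (_ * X))]big1 ?mulr1 ?mul1r// => i /mi ->.
  case: mE => i mi; have [ij|ij] := eqVneq i j.
    rewrite -ij (negbTE (_ : m i != k :> nat)) ?mulr0//.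
    by move: mi; rewrite ij /midx eqxx (negbTE jl) muln1 addn0.
  have [il|il] := eqVneq i l.
    rewrite -il (negbTE (_ : m i != 1%N :> nat)) ?andbF ?mulr0//.
    by move: mi; rewrite il /midx eqxx (negbTE lj) muln0.
  rewrite /z (bigD1 i) ?ij//= expr0n (negbTE (_ : m i != 0%N :> nat)) ?mul0r//.
  by apply: contraNneq mi => ->; rewrite /midx (negbTE ij) (negbTE il) muln0.
Qed.

(** Each Taylor term is a constant [c m], containing [h] to the order of [m], times a product of
    powers of displacements. [mom_displ] keeps only the term of [midx], of order [k.+1 <= n], and
    its factorials cancel those of the Taylor coefficient. *)
Lemma mom_taylor (g : 'rV[R]_d -> R) (x : 'rV[R]_d) (h : R) : C_class n g ->
  mom (fun u v =>
      taylor n g x (x + (h * u) *: basis_vec R j + (h * v) *: basis_vec R l)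
    - taylor n g x (x + (h * u) *: basis_vec R j - (h * v) *: basis_vec R l))
   (2 * h ^+ k.+1 * partial l (iter k (partial j) g) x).
Proof.
move=> Cg.
pose c (m : {ffun 'I_d -> 'I_n.+1}) : R :=
  (\prod_(i < d) (m i)`!%:R)^-1 * multi_deriv m g x * h ^+ (\sum_(i < d) m i).
rewrite [X in mom X](_ : _ = fun u v =>
    \sum_(m : {ffun 'I_d -> 'I_n.+1} | (\sum_(i < d) m i <= n)%N)
     c m * (\prod_(i < d) displ 1 u v i ^+ m i
                  - \prod_(i < d) displ (-1) u v i ^+ m i)); last first.
  apply/funext => u; apply/funext => v; rewrite /taylor -sumrB.
  apply: eq_bigr => m _; rewrite /c -!mulrA -!mulrBr -prodrXr.
  congr (_ * (_ * _)); rewrite mulrBr -!big_split /=.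
  congr (_ - _); apply: eq_bigr => i _; rewrite !mxE /= -exprMn; congr (_ ^+ _);
    rewrite /displ !(eq_sym i); ring.
rewrite [X in mom _ X](_ : _ =
    \sum_(m : {ffun 'I_d -> 'I_n.+1} | (\sum_(i < d) m i <= n)%N)
     c m * (if [forall i, m i == midx j k l i :> nat]
     then 2 * \prod_(i < d) (m i)`!%:R else 0)).
  by apply: mom_sum => m mn; apply: momZ; exact: mom_displ.
have sum_midx : (\sum_(i < d) midx j k l i = k.+1)%N.
  rewrite /midx big_split /= -big_distrr /= -addn1; congr (_ + _)%N.
    by rewrite (bigD1 j)//= eqxx big1 ?addn0 ?muln1// => i /negbTE ->.
  by rewrite (bigD1 l)//= eqxx big1// => i /negbTE ->.
have midx_lt i : (midx j k l i < n.+1)%N.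
  by rewrite ltnS; apply: leq_trans kn; rewrite -sum_midx (bigD1 i)//= leq_addr.
pose m := [ffun i => Ordinal (midx_lt i)].
rewrite (bigD1 m) /=; last first.
  by under eq_bigr do rewrite ffunE; rewrite sum_midx.
rewrite [X in _ + X]big1 ?addr0; last first.
  move=> m' /andP[_ m'm]; case: ifPn => [/forallP mE|_]; last by rewrite mulr0.
  case/eqP: m'm; apply/ffunP => i; apply/val_inj; rewrite ffunE /=.
  by rewrite (eqP (mE i)).
rewrite ifT /c; last by apply/forallP => i; rewrite ffunE.
have -> : multi_deriv m g = partial l (iter k (partial j) g).
  rewrite /multi_deriv.
  have -> : (fun i phi => iter (m i) (partial i) phi) =
    (fun i (phi : 'rV[R]_d -> R) => iter (midx j k l i) (partial i) phi).
    by apply/funext => i; apply/funext => phi; rewrite ffunE.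
  rewrite foldr_midx ?enum_uniq ?mem_enum ?inE ?muln1//.
  exact: C_class_le Cg.
have -> : (\sum_(i < d) m i = k.+1)%N.
  by under eq_bigr do rewrite ffunE; exact: sum_midx.
have P0 : \prod_(i < d) (m i)`!%:R != 0 :> R.
  by apply/prodf_neq0 => i _; rewrite pnatr_eq0 -lt0n fact_gt0.
field.
exact: P0.
Qed.

End taylor_moments.

(** * Measurability and integrability *)

Section measurable_row.
Context {R : realType} {d : nat} {dT : measure_display} {T : measurableType dT}.

(** Rounding down to the mesh of step 1/(n+1), so that a rounded vector has only countably many
    possible values. *)
Definition grid (n : nat) (y : R) : R := (Num.floor (n.+1%:R * y))%:~R / n.+1%:R.

Lemma grid_dist n y : `|y - grid n y| <= n.+1%:R^-1.
Proof.
have n0 : (0 : R) < n.+1%:R by [].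
have /andP[f1 f2] := floor_itv (n.+1%:R * y).
rewrite (_ : y - _ = (n.+1%:R * y - (Num.floor (n.+1%:R * y))%:~R) / n.+1%:R).
  rewrite normrM normfV (ger0_norm (ltW n0)) ler_piMl ?invr_ge0//.
  rewrite ger0_norm ?subr_ge0// lerBlDr addrC; move: f2; rewrite intrD => /ltW //.
by rewrite mulrBl mulrAC mulfV ?mul1r ?gt_eqF.
Qed.

(** After rounding the coordinates, preimages are countable unions of finite intersections of
    measurable sets. By continuity of [g] the rounded functions converge pointwise to the given
    one. *)
Lemma measurable_continuous_row (g : 'rV[R]_d -> R) (Y : 'I_d -> T -> R) :
  continuous g -> (forall i, measurable_fun setT (Y i)) ->
  measurable_fun setT (fun w => g (\row_i Y i w)).
Proof.
move=> cg mY.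
apply: (measurable_fun_cvg (h := fun n w => g (\row_i grid n (Y i w)))) => [n|w _].
- move=> _ B mB; rewrite setTI.
  pose S (z : {ffun 'I_d -> int}) : set T :=
    if g (\row_i ((z i)%:~R / n.+1%:R)) \in B then
      \bigcap_(i in [set: 'I_d])
        (Y i @^-1` [set y | (z i)%:~R <= n.+1%:R * y < (z i + 1)%:~R])
    else set0.
  rewrite (_ : _ @^-1` _ = \bigcup_z S z).
    apply: countable_bigcupT_measurable => [|z]; first exact: countableP.
    rewrite /S; case: ifPn => // _.
    apply: fin_bigcap_measurable => [|i _]; first exact: finite_finset.
    rewrite -[X in measurable X]setTI; apply: mY => //.
    rewrite (_ : [set _ | _] =
       [set` `[(z i)%:~R / n.+1%:R, (z i + 1)%:~R / n.+1%:R[%R]).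
      exact: measurable_itv.
    by apply/seteqP; split => y /=; rewrite in_itv /= ler_pdivrMr// ltr_pdivlMr// mulrC.
  apply/seteqP; split => w /=.
  + move=> Bw; exists [ffun i => Num.floor (n.+1%:R * Y i w)] => //.
    rewrite /S ifT; first by move=> i _ /=; rewrite ffunE floor_itv.
    rewrite inE; move: Bw; congr (B (g _)); apply/rowP => i.
    by rewrite !mxE ffunE.
  + move=> [z _]; rewrite /S; case: ifPn => // /set_mem Bz zw.
    move: Bz; congr (B (g _)); apply/rowP => i; rewrite !mxE /grid.
    have /= := zw i I; move=> /andP[z1 z2]; congr (_%:~R / _); apply/esym.
    by apply: floor_def; rewrite z1.
- apply: continuous_cvg; first exact: cg.
  apply/cvg_ballP => e e0; near=> n; split => // i i0; rewrite !mxE /ball /=.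
  apply: le_lt_trans (grid_dist _ _) _.
  by near: n; exact: near_infty_natSinv_lt (PosNum e0).
Unshelve. all: by end_near. Qed.

End measurable_row.

(** * Integrability from almost sure bounds, and product integrals *)

Section bounded_integrable.
Context {R : realType}.
Local Open Scope ereal_scope.

Lemma sub_ae (dT : measure_display) (T : measurableType dT)
    (mu : set T -> \bar R) (P Q : T -> Prop) :
  (forall x, P x -> Q x) -> {ae mu, forall x, P x} -> {ae mu, forall x, Q x}.
Proof.
move=> PQ [N [mN N0 sN]]; exists N; split => // x /= nQ.
by apply: sN => /= /PQ.
Qed.

Lemma ae_bounded_integrable (dT : measure_display) (T : measurableType dT)
    (mu : probability T R) (f : T -> R) (M : R) :
  measurable_fun setT f -> {ae mu, forall x, (`|f x| <= M)%R} ->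
  mu.-integrable setT (EFin \o f).
Proof.
move=> mf fM; apply/integrableP; split; first exact/measurable_EFinP.
apply: (@le_lt_trans _ _ (\int[mu]_x (`|M|)%:E)).
  apply: ae_ge0_le_integral => //.
  - by apply: measurableT_comp => //; exact/measurable_EFinP.
  - by apply: sub_ae fM => x fxM _; rewrite lee_fin (le_trans fxM)// ler_norm.
rewrite integral_cst// lte_mul_pinfty// ?lee_fin//.
by rewrite -ge0_fin_numE// fin_num_measure.
Qed.

Lemma ae_prod (d1 d2 : measure_display) (T1 : measurableType d1)
    (T2 : measurableType d2) (m1 : probability T1 R) (m2 : probability T2 R)
    (P1 : T1 -> Prop) (P2 : T2 -> Prop) :
  {ae m1, forall x, P1 x} -> {ae m2, forall y, P2 y} ->
  {ae m1 \x m2, forall z, P1 z.1 /\ P2 z.2}.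
Proof.
move=> [N1 [mN1 N10 PN1]] [N2 [mN2 N20 PN2]].
apply: filterI.
- exists (N1 `*` setT); split; first exact: measurableX.
    apply: etrans (product_measure1E m1 m2 mN1 measurableT) _.
    exact: etrans (congr1 (fun t => t * m2 setT) N10) (mul0e _).
  by move=> [x y] /= xy; split=> //; apply: PN1.
- exists (setT `*` N2); split; first exact: measurableX.
    apply: etrans (product_measure1E m1 m2 measurableT mN2) _.
    exact: etrans (congr1 (fun t => m1 setT * t) N20) (mule0 _).
  by move=> [x y] /= xy; split=> //; apply: PN2.
Qed.

Lemma integral_prodM (d1 d2 : measure_display) (T1 : measurableType d1)
    (T2 : measurableType d2) (m1 : probability T1 R) (m2 : probability T2 R)
    (p : T1 -> R) (q : T2 -> R) :
  m1.-integrable setT (EFin \o p) -> m2.-integrable setT (EFin \o q) ->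
  (m1 \x m2).-integrable setT (fun z => (p z.1 * q z.2)%:E) ->
  (\int[m1 \x m2]_z (p z.1 * q z.2) = (\int[m1]_x p x) * (\int[m2]_y q y))%R.
Proof.
move=> ip iq ipq; rewrite /Rintegral -integral12_prod_meas1//.
rewrite /fubini_F /=.
under eq_integral => x _.
  under eq_integral => y _ do rewrite EFinM.
  rewrite integralZl//.
  rewrite -(fineK (integrable_fin_num _ iq))// muleC.
  over.
rewrite /= integralZl// -(fineK (integrable_fin_num _ ip))// -EFinM /=.
by rewrite mulrC.
Qed.

End bounded_integrable.

(* Under this type the product [halfP R \x halfP R] is inferred to be a
   probability, which fails for [uniform_prob] itself. *)
Definition halfP (R : realType) : probability (measurableTypeR R) R :=
  uniform_prob (half_lt R).

(** * The uniform law on [-1/2, 1/2] and bounded kernels *)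

Section uniform_half.
Context {R : realType}.
Local Notation mu := (halfP R).

Lemma measurable_half : measurable (half_itv R).
Proof. exact: measurable_itv. Qed.

(** The interval has length one, so the density is [1]. The split into positive and negative parts
    reduces the claim to nonnegative functions. *)
Lemma integral_uniform_half (f : R -> \bar R) : measurable_fun setT f ->
  (\int[mu]_u f u = \int[lebesgue_measure]_(u in half_itv R) f u)%E.
Proof.
move=> mf; rewrite integralE [RHS]integralE.
rewrite /halfP !integral_uniform//; last 2 first.
  exact: measurable_funeneg.
  exact: measurable_funepos.
have -> : (2^-1 - - 2^-1)^-1 = 1 :> R by field.
by rewrite !mul1e.
Qed.

Lemma ae_half : {ae mu, forall u, half_itv R u}.
Proof.
exists (~` half_itv R); split => //.
  exact: measurableC measurable_half.
by rewrite /halfP /= /uniform_prob integral_uniform_pdf setICl integral_set0.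
Qed.

Lemma norm_half (u : R) : half_itv R u -> `|u| <= 2^-1.
Proof. by rewrite /half_itv /= in_itv /= ler_norml. Qed.

Lemma integrable_half (p : R -> R) : bounded_kernel p ->
  mu.-integrable setT (EFin \o p).
Proof.
move=> [mp [M pM]]; apply: (@ae_bounded_integrable _ _ _ _ _ M) => //.
by apply: sub_ae ae_half => u; exact: pM.
Qed.

Lemma integrable_half_prod (p : R * R -> R) (M : R) : measurable_fun setT p ->
  (forall u v, half_itv R u -> half_itv R v -> `|p (u, v)| <= M) ->
  (mu \x mu)%E.-integrable setT (EFin \o p).
Proof.
move=> mp pM; apply: (@ae_bounded_integrable _ _ _ (mu \x mu)%E _ M) => //.
by apply: sub_ae (@ae_prod _ _ _ _ _ mu mu _ _ ae_half ae_half)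
  => -[u v] /= [hu hv]; exact: pM.
Qed.

Lemma bounded_kernelM (p q : R -> R) : bounded_kernel p -> bounded_kernel q ->
  bounded_kernel (fun u => p u * q u).
Proof.
move=> [mp [M pM]] [mq [N qN]]; split; first exact: measurable_funM.
by exists (M * N) => u hu; rewrite normrM ler_pM// ?pM ?qN.
Qed.

Lemma bounded_kernelX (a : nat) : bounded_kernel (fun u : R => u ^+ a).
Proof.
split; first exact: measurable_funX.
exists 1 => u /norm_half hu; rewrite normrX exprn_ile1// (le_trans hu)//.
by rewrite invf_le1// ler1n.
Qed.

Lemma bounded_kernel_norm (p : R -> R) : bounded_kernel p ->
  bounded_kernel (fun u => `|p u|).
Proof.
move=> [mp [M pM]]; split; first exact: measurableT_comp.
by exists M => u hu; rewrite normr_id pM.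
Qed.

Lemma kernel_momentE (K : R -> R) a : measurable_fun setT K ->
  kernel_moment K a = \int[mu]_u (u ^+ a * K u).
Proof.
move=> mK; rewrite /kernel_moment /Rintegral integral_uniform_half//.
by apply/measurable_EFinP; apply: measurable_funM => //; exact: measurable_funX.
Qed.

Lemma integral_half_prodM (p q : R -> R) : bounded_kernel p -> bounded_kernel q ->
  (mu \x mu)%E.-integrable setT (fun z => (p z.1 * q z.2)%:E) /\
  \int[(mu \x mu)%E]_z (p z.1 * q z.2) = (\int[mu]_u p u) * (\int[mu]_v q v).
Proof.
move=> bp bq; have i : (mu \x mu)%E.-integrable setT (fun z => (p z.1 * q z.2)%:E).
  case: bp bq => [mp [M pM]] [mq [N qN]].
  apply: (@integrable_half_prod _ (M * N)).
    by apply: measurable_funM; apply: measurableT_comp.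
  by move=> u v hu hv /=; rewrite normrM ler_pM// ?pM ?qN.
split => //; apply: integral_prodM => //; exact: integrable_half.
Qed.

(* The variance of [|K|] is nonnegative. *)
Lemma integral_norm_le_sqrt (K : R -> R) : bounded_kernel K ->
  \int[mu]_u `|K u| <= Num.sqrt (fine 'E_mu[fun u => K u ^+ 2]).
Proof.
move=> bK; set m := \int[mu]_u `|K u|.
have m0 : 0 <= m by apply: Rintegral_ge0.
rewrite -(ger0_norm m0) -sqrtr_sqr ler_wsqrtr// unlock -/(Rintegral mu setT _).
have iK := integrable_half _ (bounded_kernel_norm _ bK).
have iK2 : mu.-integrable setT (EFin \o (fun u => K u ^+ 2)).
  exact: (integrable_half _ (bounded_kernelM _ _ bK bK)).
have i1 : mu.-integrable setT (EFin \o (fun u => 2 * m * `|K u|)).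
  apply: (integrable_half (fun u => 2 * m * `|K u|)).
  apply: (bounded_kernelM (fun=> 2 * m) (fun u => `|K u|)); last exact: bounded_kernel_norm.
  by split => //; exists `|2 * m|.
have i2 : mu.-integrable setT (EFin \o (fun=> m ^+ 2)).
  exact: finite_measure_integrable_cst.
rewrite -subr_ge0.
have -> : \int[mu]_u K u ^+ 2 - m ^+ 2 =
    \int[mu]_u (K u ^+ 2 - 2 * m * `|K u| + m ^+ 2).
  rewrite RintegralD//; last first.
    exact: (integrableB measurableT iK2 i1).
  rewrite RintegralB// RintegralZl// Rintegral_cst//= probability_setT /=.
  by rewrite -/m; ring.
apply: Rintegral_ge0 => u _.
by rewrite -(real_normK (num_real (K u))) (_ : _ + _ = (`|K u| - m) ^+ 2) ?sqr_ge0//; ring.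
Qed.

End uniform_half.

(** * Bias at a fixed point *)

Section bias.
Context {R : realType} {d : nat}.
Local Notation mu := (halfP R).

Lemma ae_le_Rintegral (dT : measure_display) (T : measurableType dT)
    (P : probability T R) (f1 f2 : T -> R) :
  P.-integrable setT (EFin \o f1) -> P.-integrable setT (EFin \o f2) ->
  (forall x, 0 <= f1 x) -> (forall x, 0 <= f2 x) ->
  {ae P, forall x, f1 x <= f2 x} -> \int[P]_x f1 x <= \int[P]_x f2 x.
Proof.
move=> i1 i2 f10 f20 f12; apply: fine_le.
- exact: (integrable_fin_num measurableT i1).
- exact: (integrable_fin_num measurableT i2).
- apply: ae_ge0_le_integral => //.
  + by move=> x _; rewrite lee_fin.
  + exact: measurable_int i1.
  + by move=> x _; rewrite lee_fin.
  + exact: measurable_int i2.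
  + by apply: sub_ae f12 => x ? _; rewrite lee_fin.
Qed.

(** The separate constant [c] is taken to be [h] or [- h], which covers both query points. *)
Lemma measurable_shift (dT : measure_display) (T : measurableType dT)
    (j l : 'I_d) (h c : R) (g : 'rV[R]_d -> R) (X : 'I_d -> T -> R) (U V : T -> R) :
  continuous g -> (forall i, measurable_fun setT (X i)) ->
  measurable_fun setT U -> measurable_fun setT V ->
  measurable_fun setT (fun w => g (rand_vec X w + (h * U w) *: basis_vec R j
                                   + (c * V w) *: basis_vec R l)).
Proof.
move=> cg mX mU mV.
rewrite (_ : (fun _ => _) = fun w => g (\row_i
  (X i w + h * U w * basis_vec R j 0 i + c * V w * basis_vec R l 0 i))).
  apply: measurable_continuous_row => // i.
  apply: measurable_funD; first apply: measurable_funD => //.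
    by apply: measurable_funM => //; apply: measurable_funM.
  by apply: measurable_funM => //; apply: measurable_funM.
by apply/funext => w; congr g; apply/rowP => i; rewrite !mxE.
Qed.

(** The coordinatewise inequality (p + q)^2 <= 2 p^2 + 2 q^2 treats [j = l] and [j != l] alike.
    Summed over the coordinates it gives 2 h^2 (u^2 + v^2), at most h^2 because u^2 and v^2 are at
    most 1/4. *)
Lemma enorm_shift (j l : 'I_d) (h c : R) (x : 'rV[R]_d) (u v : R) :
  0 < h -> `|c| = h -> half_itv R u -> half_itv R v ->
  enorm (x + (h * u) *: basis_vec R j + (c * v) *: basis_vec R l - x) <= h.
Proof.
move=> h0 ch /norm_half hu /norm_half hv.
rewrite -[X in _ <= X](ger0_norm (ltW h0)) -sqrtr_sqr; apply: ler_wsqrtr.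
have sq (a : R) (i j' : 'I_d) : (i == j')%:R ^+ 2 = (i == j')%:R :> R.
  by case: eqP; rewrite ?expr1n ?expr0n.
apply: (@le_trans _ _ (\sum_(i < d) (2 * (h ^+ 2 * u ^+ 2) * (i == j)%:R
  + 2 * (h ^+ 2 * v ^+ 2) * (i == l)%:R))).
  apply: ler_sum => i _; rewrite !mxE /= ?eqxx /= [_ - x 0 i]addrC !addrA addNr add0r.
  rewrite -[X in _ <= _ * X + _]sq// -[X in _ <= _ + _ * X]sq//.
  have -> : h ^+ 2 * v ^+ 2 = c ^+ 2 * v ^+ 2.
    by rewrite -ch real_normK ?num_real.
  rewrite -subr_ge0; set a := (i == j)%:R; set b := (i == l)%:R.
  rewrite (_ : _ - _ = (h * u * a - c * v * b) ^+ 2) ?sqr_ge0//; ring.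
rewrite big_split /= -!mulr_sumr.
have one (j' : 'I_d) : \sum_(i < d) (i == j')%:R = 1 :> R.
  by rewrite (bigD1 j')//= eqxx big1 ?addr0// => i /negbTE ->.
rewrite !one !mulr1 -mulrDr -mulrDr mulrCA ger_pMr ?exprn_gt0//.
have q (t : R) : `|t| <= 2^-1 -> t ^+ 2 <= 4^-1.
  move=> ht; rewrite -(real_normK (num_real t)).
  by rewrite (_ : 4^-1 = 2^-1 ^+ 2 :> R) ?lerXn2r ?nnegrE ?invr_ge0//; field.
have := q _ hu; have := q _ hv; lra.
Qed.

(** Since [1 < beta], the integer k+1 is strictly below [beta + k%:R]; hence the Taylor polynomial
    reaches the order k+1 of the target derivative. *)
Lemma lt_strict_floor (beta : R) k : 1 < beta ->
  (k < strict_floor (beta + k%:R))%N.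
Proof.
move=> b1; have [|_ /(_ k.+1%:Z)] := @strict_floorP R (beta + k%:R).
  by rewrite ltr_pwDl// (lt_trans _ b1).
by rewrite lez_nat; apply; rewrite -[k.+1%:~R]/(k.+1%:R) -natr1 addrC ltrD2r.
Qed.

Lemma bounded_deriv_kernel {i m : nat} {K : R -> R} :
  deriv_kernel i m K -> bounded_kernel K.
Proof. by case. Qed.

Lemma bounded_grad_kernel {m : nat} {K : R -> R} :
  grad_kernel m K -> bounded_kernel K.
Proof. by case. Qed.

Variables (j l : 'I_d) (k : nat) (beta L h : R) (g : 'rV[R]_d -> R) (Kk K1 : R -> R).
Hypotheses (b1 : 1 < beta) (L0 : 0 < L) (h0 : 0 < h)
  (gH : holder_class (beta + k%:R) L g)
  (HKk : deriv_kernel k (strict_floor (beta + k%:R)) Kk)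
  (HK1 : grad_kernel (strict_floor (beta + k%:R)) K1).
Local Notation n := (strict_floor (beta + k%:R)).

Definition gdiff (x : 'rV[R]_d) (u v : R) : R :=
  g (x + (h * u) *: basis_vec R j + (h * v) *: basis_vec R l)
  - g (x + (h * u) *: basis_vec R j - (h * v) *: basis_vec R l).

Definition tdiff (x : 'rV[R]_d) (u v : R) : R :=
  taylor n g x (x + (h * u) *: basis_vec R j + (h * v) *: basis_vec R l)
  - taylor n g x (x + (h * u) *: basis_vec R j - (h * v) *: basis_vec R l).

(** The concrete instance of [mom]. Integrability is bundled with the value so that additivity and
    scaling of the integral can be applied. *)
Definition kernel_mean (p : R -> R -> R) (r : R) : Prop :=
  (mu \x mu)%E.-integrable setT
    (fun z => (Kk z.1 * K1 z.2 * p z.1 z.2)%:E) /\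
  \int[(mu \x mu)%E]_z (Kk z.1 * K1 z.2 * p z.1 z.2) = r.

Lemma kernel_mean_tdiff x : kernel_mean (tdiff x)
  (2 * h ^+ k.+1 * partial l (iter k (partial j) g) x).
Proof.
apply: (mom_taylor j l k n (kernel_moment Kk) (kernel_moment K1)).
- rewrite /kernel_mean.
  have -> : (fun z : R * R => (Kk z.1 * K1 z.2 * 0)%:E) = EFin \o cst 0.
    by apply/funext => z; rewrite mulr0.
  split; first exact: integrable0.
  by under eq_Rintegral do rewrite mulr0; rewrite Rintegral_cst// mul0r.
- move=> p q a b [ip Ep] [iq Eq].
  have E z : Kk z.1 * K1 z.2 * (p z.1 z.2 + q z.1 z.2) =
      Kk z.1 * K1 z.2 * p z.1 z.2 + Kk z.1 * K1 z.2 * q z.1 z.2.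
    by rewrite mulrDr.
  split; last by under eq_Rintegral do rewrite E; rewrite RintegralD// Ep Eq.
  under eq_fun do rewrite E EFinD.
  exact: integrableD.
- move=> c p a [ip Ep].
  have E z : Kk z.1 * K1 z.2 * (c * p z.1 z.2) =
      c * (Kk z.1 * K1 z.2 * p z.1 z.2) by rewrite mulrCA.
  split; last by under eq_Rintegral do rewrite E; rewrite RintegralZl// Ep.
  under eq_fun do rewrite E EFinM.
  exact: integrableZl.
- move=> a b; have [mK _] := bounded_deriv_kernel HKk.
  have [mK1 _] := bounded_grad_kernel HK1.
  have [i e] := integral_half_prodM _ _
    (bounded_kernelM _ _ (bounded_kernelX a) (bounded_deriv_kernel HKk))
    (bounded_kernelM _ _ (bounded_kernelX b) (bounded_grad_kernel HK1)).
  have E z : Kk z.1 * K1 z.2 * (z.1 ^+ a * z.2 ^+ b) =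
     (z.1 ^+ a * Kk z.1) * (z.2 ^+ b * K1 z.2) by ring.
  split; first by under eq_fun do rewrite E.
  by under eq_Rintegral do rewrite E; rewrite e !kernel_momentE.
- exact: lt_strict_floor.
- by case: HKk.
- by case: HKk.
- by case: HK1.
- by case: HK1.
- by case: HK1.
- by case: gH.
Qed.

Lemma ler_dist_subB (a b c e t : R) : `|a - c| <= t -> `|b - e| <= t ->
  `|(a - b) - (c - e)| <= 2 * t.
Proof.
move=> ac be; rewrite (_ : _ - _ = (a - c) - (b - e)); last by ring.
by rewrite mulr2n mulrDl mul1r (le_trans (ler_normB _ _))// lerD.
Qed.

(** Both query points are within [h] of [x] by [enorm_shift], so the Hölder remainder is counted
    twice. *)
Lemma gdiff_tdiff x u v : half_itv R u -> half_itv R v ->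
  `|gdiff x u v - tdiff x u v| <= 2 * L * h `^ (beta + k%:R).
Proof.
move=> hu hv; have [_ gT] := gH.
have le_pow (z : 'rV[R]_d) : enorm (z - x) <= h ->
    `|g z - taylor n g x z| <= L * h `^ (beta + k%:R).
  move=> zh; apply: le_trans (gT x z) _; rewrite ler_pM2l//.
  apply: ge0_ler_powR => //; rewrite ?nnegrE ?sqrtr_ge0 ?(ltW h0)//.
  by rewrite addr_ge0// (le_trans _ (ltW b1)).
have z1 := le_pow _ (enorm_shift j l h h x u v h0 (ger0_norm (ltW h0)) hu hv).
have hN : `|- h| = h by rewrite normrN ger0_norm ?ltW.
have := le_pow _ (enorm_shift j l h (- h) x u v h0 hN hu hv).
rewrite mulNr scaleNr => z2.
rewrite /gdiff /tdiff -mulrA; exact: (ler_dist_subB _ _ _ _ _ z1 z2).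
Qed.

(** Mean of the noiseless estimator with the current point frozen at [x]; evaluated at the random
    point it will be the conditional expectation. *)
Definition mean_est (x : 'rV[R]_d) : R :=
  \int[(mu \x mu)%E]_z (Kk z.1 * K1 z.2 / (2 * h ^+ k.+1) * gdiff x z.1 z.2).

(** The Taylor part integrates to [2 * h ^+ k.+1] times the target derivative, and the normalization
    of the estimator cancels that factor. The bias is therefore the integral of the remainder,
    bounded through the L1 norms of the kernels and then through their L2 norms. *)
Lemma mean_est_bias x :
  (mu \x mu)%E.-integrable setT
    (fun z => (Kk z.1 * K1 z.2 / (2 * h ^+ k.+1) * gdiff x z.1 z.2)%:E) /\
  `|mean_est x - partial l (iter k (partial j) g) x|
    <= C_bias L Kk K1 * h `^ (beta - 1).
Proof.
have cg : continuous g by have [[_ cg] _] := gH; exact: (cg [::]).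
have [mKk [M1 M1P]] := bounded_deriv_kernel HKk.
have [mK1 [M2 M2P]] := bounded_grad_kernel HK1.
have [iT ET] := kernel_mean_tdiff x.
pose W (z : R * R) := Kk z.1 * K1 z.2.
have mW : measurable_fun setT W.
  by apply: measurable_funM; apply: measurableT_comp.
have mG : measurable_fun setT (fun z : R * R => gdiff x z.1 z.2).
  pose X i (_ : R * R) := x 0 i.
  have XE z : rand_vec X z = x by apply/rowP => i; rewrite !mxE.
  apply: measurable_funB.
    have := @measurable_shift _ _ j l h h g X fst snd cg.
    under eq_fun do rewrite XE.
    by apply=> [i| |]; [exact: measurable_cst|exact: measurable_fst|exact: measurable_snd].
  have := @measurable_shift _ _ j l h (- h) g X fst snd cg.
  under eq_fun do rewrite XE mulNr scaleNr.
  by apply=> [i| |]; [exact: measurable_cst|exact: measurable_fst|exact: measurable_snd].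
pose B := 2 * L * h `^ (beta + k%:R).
pose rem z := W z * gdiff x z.1 z.2 - W z * tdiff x z.1 z.2.
have mrem : measurable_fun setT rem.
  apply: measurable_funB; first exact: measurable_funM.
  by apply/measurable_EFinP; exact: measurable_int iT.
have rem_le u v : half_itv R u -> half_itv R v ->
    `|rem (u, v)| <= `|Kk u| * `|K1 v| * B.
  move=> hu hv; rewrite /rem -mulrBr normrM /W normrM ler_wpM2l//.
  exact: gdiff_tdiff.
have B0 : 0 <= B by rewrite !mulr_ge0 ?powR_ge0 ?(ltW L0).
have irem : (mu \x mu)%E.-integrable setT (EFin \o rem).
  apply: (integrable_half_prod _ (M1 * M2 * B)) => // u v hu hv.
  apply: le_trans (rem_le _ _ hu hv) _; rewrite ler_wpM2r// ler_pM//;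
    [exact: M1P|exact: M2P].
have iG : (mu \x mu)%E.-integrable setT
    (EFin \o (fun z => W z * gdiff x z.1 z.2)).
  have -> : (fun z => W z * gdiff x z.1 z.2) =
      fun z => W z * tdiff x z.1 z.2 + rem z.
    by apply/funext => z; rewrite /rem addrC subrK.
  exact: (integrableD measurableT iT irem).
have hk0 : 0 < 2 * h ^+ k.+1 by rewrite mulr_gt0// exprn_gt0.
have E z : Kk z.1 * K1 z.2 / (2 * h ^+ k.+1) * gdiff x z.1 z.2 =
    (2 * h ^+ k.+1)^-1 * (W z * gdiff x z.1 z.2).
  by rewrite /W mulrAC mulrC.
split.
  under eq_fun do rewrite E EFinM.
  exact: integrableZl.
have -> : mean_est x = (2 * h ^+ k.+1)^-1 * \int[(mu \x mu)%E]_z (W z * gdiff x z.1 z.2).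
  by rewrite /mean_est; under eq_Rintegral do rewrite E; rewrite RintegralZl.
have -> : \int[(mu \x mu)%E]_z (W z * gdiff x z.1 z.2) =
    2 * h ^+ k.+1 * partial l (iter k (partial j) g) x + \int[(mu \x mu)%E]_z rem z.
  rewrite -ET -RintegralD//; apply: eq_Rintegral => z _.
  by rewrite /rem addrC subrK.
rewrite mulrDr mulKf ?gt_eqF// addrAC subrr add0r.
rewrite normrM normfV (gtr0_norm hk0) mulrC ler_pdivrMr//.
have [iK EK] := integral_half_prodM _ _
  (bounded_kernel_norm _ (bounded_deriv_kernel HKk))
  (bounded_kernel_norm _ (bounded_grad_kernel HK1)).
apply: le_trans (le_normr_Rintegral measurableT irem) _.
apply: (@le_trans _ _ (\int[(mu \x mu)%E]_z (`|Kk z.1| * `|K1 z.2| * B))).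
  apply: (@ae_le_Rintegral _ _ (mu \x mu)%E) => //.
  - exact: (integrable_abse irem).
  - exact: (integrableZr measurableT B iK).
  - by move=> z; rewrite mulr_ge0.
  - by apply: sub_ae (@ae_prod _ _ _ _ _ mu mu _ _ ae_half ae_half)
      => -[u v] /= [hu hv]; exact: rem_le.
rewrite RintegralZr// EK.
have -> : C_bias L Kk K1 * h `^ (beta - 1) * (2 * h ^+ k.+1) =
   (Num.sqrt (fine 'E_mu[fun u => Kk u ^+ 2]) *
    Num.sqrt (fine 'E_mu[fun u => K1 u ^+ 2])) * B.
  (* The exponent beta + k splits as (beta - 1) + (k + 1); the second power and the factor [2] match
     the normalization of the estimator. *)
  have -> : B = 2 * L * (h `^ (beta - 1) * h ^+ k.+1).
    rewrite /B -powR_mulrn ?ltW// -powRD; last by rewrite (gt_eqF h0) implybT.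
    by congr (_ * _ `^ _); rewrite -natr1; ring.
  rewrite /C_bias -/(halfP R).
  move: (Num.sqrt _) (Num.sqrt _) (_ `^ _) (_ ^+ _) => *; ring.
rewrite ler_wpM2r// ler_pM ?integral_norm_le_sqrt//.
- by apply: Rintegral_ge0.
- by apply: Rintegral_ge0.
- exact: bounded_deriv_kernel HKk.
- exact: bounded_grad_kernel HK1.
Qed.

End bias.

(** * Conditional expectation by freezing *)

Section freezing.
Context {R : realType} {dO : measure_display} {Omega : measurableType dO}.
Variables (P : probability Omega R) (S : set (set Omega)).
Hypothesis S_sub : <<s S >> `<=` measurable.
Local Notation Omega' := (g_sigma_algebraType S).

Lemma measurable_to_sub : measurable_fun setT (id : Omega -> Omega').
Proof. by move=> _ B mB; rewrite setTI; exact: S_sub. Qed.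

(** The identity as a map onto the same set with a smaller sigma-algebra; its law under [P] is the
    restriction of [P] to [<<s S >>]. *)
Definition to_sub : {mfun Omega >-> Omega'} :=
  MeasurableFun.Pack (MeasurableFun.Class
    (isMeasurableFun.Build _ _ _ _ _ measurable_to_sub)).

Definition sub_prob : probability Omega' R := distribution P to_sub.

Lemma integral_sub_prob (f : Omega -> \bar R) (B : set Omega) : <<s S >> B ->
  measurable_fun setT (f : Omega' -> \bar R) -> P.-integrable B f ->
  (sub_prob.-integrable B f /\
   \int[sub_prob]_(w in B) f w = \int[P]_(w in B) f w)%E.
Proof.
move=> SB mf fi; split.
  exact: (integrable_pushforward measurable_to_sub mf).
exact: (integral_pushforward measurable_to_sub).
Qed.

Lemma sub_measurable (Z : Omega -> R) :
  (forall B, measurable B -> <<s S >> (Z @^-1` B)) ->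
  measurable_fun setT (Z : Omega' -> R).
Proof. by move=> mZ _ B mB; rewrite setTI; exact: mZ. Qed.

(** Both versions are measurable for [<<s S >>] and have equal integrals over its sets, so they
    agree almost everywhere under the restricted measure. Its null sets are null for [P]. *)
Lemma condexp_unique (Y Z1 Z2 : Omega -> R) :
  is_condexp P <<s S >> Y Z1 -> is_condexp P <<s S >> Y Z2 ->
  {ae P, forall w, Z1 w = Z2 w}.
Proof.
move=> [_ i1 m1 e1] [_ i2 m2 e2].
have mZ1 : measurable_fun setT (EFin \o Z1 : Omega' -> \bar R).
  by apply/measurable_EFinP; exact: (sub_measurable Z1 m1).
have mZ2 : measurable_fun setT (EFin \o Z2 : Omega' -> \bar R).
  by apply/measurable_EFinP; exact: (sub_measurable Z2 m2).
have ST : <<s S >> setT by exact: (@measurableT _ Omega').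
have [iZ1 _] := integral_sub_prob _ _ ST mZ1 i1.
have : ae_eq sub_prob setT (EFin \o Z1) (EFin \o Z2).
  apply: integral_ae_eq => // E _ mE.
  have [|_ ->] := integral_sub_prob (EFin \o Z1) E mE mZ1.
    by apply: integrableS i1 => //; exact: S_sub.
  have [|_ ->] := integral_sub_prob (EFin \o Z2) E mE mZ2.
    by apply: integrableS i2 => //; exact: S_sub.
  by rewrite /= e1// e2.
move=> [N [mN N0 sN]]; exists N; split => //; first exact: S_sub.
move=> w /= Zw; apply: sN => /= /(_ I) [] ?; exact: Zw.
Qed.

Variables (dT : measure_display) (T : measurableType dT) (mu : probability T R)
  (Y : Omega -> T).
Hypotheses (mY : measurable_fun setT Y)
  (muY : forall A, measurable A -> P (Y @^-1` A) = mu A)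
  (indep : forall A B, measurable A -> <<s S >> B ->
     P (Y @^-1` A `&` B) = (P (Y @^-1` A) * P B)%E).

Let Phi (w : Omega) : Omega' * T := (w, Y w).

Lemma measurable_pair_sub : measurable_fun setT Phi.
Proof. by apply: measurable_fun_pair => //; exact: measurable_to_sub. Qed.

Definition pair_sub : {mfun Omega >-> (Omega' * T)%type} :=
  MeasurableFun.Pack (MeasurableFun.Class
    (isMeasurableFun.Build _ _ _ _ _ measurable_pair_sub)).

(** On rectangles this is the independence of [Y] from [<<s S >>], and rectangles determine a
    product measure. *)
Lemma law_pair_sub (A : set (Omega' * T)) : measurable A ->
  (sub_prob \x mu)%E A = distribution P pair_sub A.
Proof.
apply: product_measure_unique => A1 A2 mA1 mA2.
transitivity (P (Y @^-1` A2 `&` A1)).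
  by congr (P _); apply/seteqP; split => w [].
by rewrite indep// muY// muleC.
Qed.

(* Under the joint law of [(w, Y w)], which is a product, integrating out the
   second coordinate is conditioning on the first. *)
Lemma integral_freeze (H : Omega' * T -> R) :
  measurable_fun setT H -> P.-integrable setT (fun w => (H (w, Y w))%:E) ->
  (forall w, mu.-integrable setT (fun y => (H (w, y))%:E)) ->
  let Z w := \int[mu]_y H (w, y) in
  [/\ measurable_fun setT (Z : Omega' -> R), P.-integrable setT (EFin \o Z)
    & forall B, <<s S >> B ->
       (\int[P]_(w in B) (Z w)%:E = \int[P]_(w in B) (H (w, Y w))%:E)%E].
Proof.
move=> mH iH iHw Z.
have mHE : measurable_fun setT (EFin \o H) by exact/measurable_EFinP.
have iD : (distribution P pair_sub).-integrable setT (EFin \o H).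
  exact: (integrable_pushforward measurable_pair_sub mHE).
have iQ : (sub_prob \x mu)%E.-integrable setT (EFin \o H).
  apply/integrableP; split => //.
  rewrite (eq_measure_integral (distribution P pair_sub)); last first.
    by move=> A mA _; exact: law_pair_sub.
  by have /integrableP[] := iD.
have ZE : EFin \o Z = fubini_F mu (EFin \o H).
  apply/funext => w; rewrite /fubini_F /= /Z /Rintegral fineK//.
  exact: (integrable_fin_num measurableT (iHw w)).
have mZ : measurable_fun setT (Z : Omega' -> R).
  by apply/measurable_EFinP; rewrite ZE; exact: measurable_fubini_F iQ.
have mZE : measurable_fun setT (EFin \o Z : Omega' -> \bar R).
  exact/measurable_EFinP.
have iZ' : sub_prob.-integrable setT (EFin \o Z).
  by rewrite ZE; exact: integrable_fubini_F iQ.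
have iZ : P.-integrable setT (EFin \o Z).
  have mZP : measurable_fun setT (EFin \o Z : Omega -> \bar R).
    exact: (measurableT_comp mZE measurable_to_sub).
  apply/integrableP; split => //.
  have /integrableP[_] := iZ'.
  rewrite ge0_integral_pushforward//.
  by apply: measurableT_comp.
split => // B SB.
have [|_ <-] := integral_sub_prob (EFin \o Z) B SB mZE.
  by apply: integrableS iZ => //; exact: S_sub.
have mBT : measurable ((B : set Omega') `*` [set: T]) by exact: measurableX.
(* Both sides equal the integral over the cylinder above [B]: one by Fubini, the other by change of
   variables along [Phi]. *)
transitivity (\int[sub_prob \x mu]_(z in B `*` setT) (H z)%:E)%E.
  rewrite [RHS]integral_mkcond -integral12_prod_meas1; last first.
    apply: (iffLR (integrable_mkcond (EFin \o H) mBT)).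
    exact: (integrableS measurableT mBT (@subsetT _ _) iQ).
  rewrite integral_mkcond; apply: eq_integral => w _.
  rewrite /fubini_F patchE; case: ifPn => wB.
    rewrite ZE /fubini_F; apply: eq_integral => y _; rewrite patchE ifT//.
    by rewrite inE; split => //=; exact: set_mem.
  apply/esym/integral0_eq => y _; rewrite patchE ifF//.
  by apply/negbTE; apply: contra wB; rewrite !inE => -[].
rewrite (eq_measure_integral (distribution P pair_sub)); last first.
  by move=> A mA _; exact: law_pair_sub.
have BE : Phi @^-1` (B `*` setT) = B by apply/seteqP; split => w //= [].
rewrite -[in RHS]BE; apply: (integral_pushforward measurable_pair_sub mHE) => //.
by rewrite BE; apply: integrableS iH => //; exact: S_sub.
Qed.

End freezing.

(** * Sigma-algebras generated by families of random variables *)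

Section sigma_of_facts.
Context {R : realType} {dO : measure_display} {Omega : measurableType dO}.
Implicit Types (I J : Type).

(** The generators inside [sigma_of], named so that the freezing results can be applied with them as
    [S]. *)
Definition gen_of I (W : I -> Omega -> R) : set (set Omega) :=
  \bigcup_i preimage_set_system setT (W i) measurable.

Lemma gen_of_preimage I (W : I -> Omega -> R) i (B : set R) : measurable B ->
  <<s gen_of I W >> (W i @^-1` B).
Proof.
move=> mB; apply: sub_gen_smallest; exists i => //; exists B => //.
by rewrite setTI.
Qed.

Lemma sigma_of_sub I (W : I -> Omega -> R) :
  (forall i, measurable_fun setT (W i)) -> <<s gen_of I W >> `<=` measurable.
Proof.
move=> mW; apply: smallest_sub; first exact: sigma_algebra_measurable.
by move=> _ [i _ [B mB <-]]; exact: mW.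
Qed.

Lemma gen_of_subset I J (W : I -> Omega -> R) (W' : J -> Omega -> R) :
  (forall i, exists i', W i = W' i') -> <<s gen_of I W >> `<=` <<s gen_of J W' >>.
Proof.
move=> WW'; apply: smallest_sub; first exact: smallest_sigma_algebra.
move=> _ [i _ [B mB <-]]; have [i' ->] := WW' i.
by rewrite setTI; exact: gen_of_preimage.
Qed.

End sigma_of_facts.

(** * The noisy estimator at a random point *)

Section oracle.
Context {R : realType} {d : nat} {dO : measure_display} {Omega : measurableType dO}.
Variable P : probability Omega R.

Lemma ae_le_integrable (f g : Omega -> R) : measurable_fun setT f ->
  P.-integrable setT (EFin \o g) -> {ae P, forall w, `|f w| <= g w} ->
  P.-integrable setT (EFin \o f).
Proof.
move=> mf /integrableP[mg ig] fg; apply/integrableP; split.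
  exact/measurable_EFinP.
apply: le_lt_trans ig; apply: ae_ge0_le_integral => //.
- by apply: measurableT_comp => //; exact/measurable_EFinP.
- exact: measurableT_comp.
- by apply: sub_ae fg => w fgw _ /=; rewrite lee_fin (le_trans fgw)// ler_norm.
Qed.

(** The absolute value of [e] is dominated by [1 + e ^+ 2], which is integrable for a
    probability. *)
Lemma square_integrable (e : Omega -> R) (s : R) : measurable_fun setT e ->
  ('E_P[(fun w => e w ^+ 2)%R] <= s%:E)%E -> P.-integrable setT (EFin \o e).
Proof.
move=> me; rewrite unlock => es.
have me2 : measurable_fun setT (fun w => e w ^+ 2) by exact: measurable_funX.
have i2 : P.-integrable setT (EFin \o (fun w => e w ^+ 2)).
  apply/integrableP; split; first exact/measurable_EFinP.
  apply: (@le_lt_trans _ _ s%:E); last exact: ltry.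
  under eq_integral => w _ do rewrite /= ger0_norm ?sqr_ge0//.
  exact: es.
apply: (@ae_le_integrable _ (fun w => 1 + e w ^+ 2)) => //.
  exact: (integrableD measurableT (finite_measure_integrable_cst P 1 measurableT) i2).
apply: aeW => w; rewrite -(real_normK (num_real (e w))).
have := sqr_ge0 (`|e w| - 1); have := normr_ge0 (e w); nra.
Qed.

Lemma bounded_on_box (g : 'rV[R]_d -> R) (M : R) : continuous g ->
  exists B : R, forall x : 'rV[R]_d, (forall i, `|x 0 i| <= M) -> `|g x| <= B.
Proof.
move=> cg.
pose K := [set x : 'rV[R]_d | forall i, `[- M, M]%classic (x ord0 i)].
have cK : compact K by apply: (@rV_compact R d (fun=> _)) => i; exact: segment_compact.
have /compact_bounded [B [_ BP]] : compact (g @` K).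
  apply: continuous_compact => //; exact: continuous_subspaceT.
(* Boundedness of the image is stated for every constant strictly above [B], whence [B + 1]. *)
exists (B + 1) => x xM; apply: (BP (B + 1)); first by rewrite ltrDl.
by exists x => // i /=; rewrite in_itv /= -ler_norml xM.
Qed.

Lemma coord_le_enorm (x : 'rV[R]_d) i : `|x 0 i| <= enorm x.
Proof.
rewrite -sqrtr_sqr; apply: ler_wsqrtr; rewrite (bigD1 i)//= lerDl.
by apply: sumr_ge0 => *; exact: sqr_ge0.
Qed.

Variables (j l : 'I_d) (k : nat) (beta L h : R) (g : 'rV[R]_d -> R) (Kk K1 : R -> R).
Hypotheses (b1 : 1 < beta) (L0 : 0 < L) (h0 : 0 < h)
  (gH : holder_class (beta + k%:R) L g)
  (HKk : deriv_kernel k (strict_floor (beta + k%:R)) Kk)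
  (HK1 : grad_kernel (strict_floor (beta + k%:R)) K1).
Local Notation mu := (halfP R).
Local Notation mu2 := (halfP R \x halfP R)%E.

Lemma continuous_holder : continuous g.
Proof. by have [[_ cg] _] := gH; exact: (cg [::]). Qed.

(** The estimator with its two sources of randomness separated: the first component carries the
    current point and the noises, the second the pair (u, v) to be integrated out. *)
Definition noisy_est (X : 'I_d -> Omega -> R) (e1 e2 : Omega -> R)
    (p : Omega * (R * R)) : R :=
  Kk p.2.1 * K1 p.2.2 / (2 * h ^+ k.+1)
  * (g (rand_vec X p.1 + (h * p.2.1) *: basis_vec R j + (h * p.2.2) *: basis_vec R l)
     + e1 p.1
     - (g (rand_vec X p.1 + (h * p.2.1) *: basis_vec R j - (h * p.2.2) *: basis_vec R l)
     + e2 p.1)).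

Lemma noisy_estE X e1 e2 w z : noisy_est X e1 e2 (w, z) =
  Kk z.1 * K1 z.2 / (2 * h ^+ k.+1) * gdiff j l h g (rand_vec X w) z.1 z.2
  + (e1 w - e2 w) / (2 * h ^+ k.+1) * (Kk z.1 * K1 z.2).
Proof.
rewrite /noisy_est /gdiff /=.
move: (g _) (g _) (e1 w) (e2 w) (_ ^-1) => *; ring.
Qed.

(* The noises disappear because [K1] has mean zero. *)
Lemma noisy_est_mean X e1 e2 w :
  mu2.-integrable setT (fun z => (noisy_est X e1 e2 (w, z))%:E) /\
  \int[mu2]_z noisy_est X e1 e2 (w, z) = mean_est j l k h g Kk K1 (rand_vec X w).
Proof.
have [i1 _] := mean_est_bias j l k beta L h g Kk K1 b1 L0 h0 gH HKk HK1 (rand_vec X w).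
have bK := bounded_deriv_kernel HKk.
have bK' := bounded_grad_kernel HK1.
have [i2 e] := integral_half_prodM _ _ bK bK'.
have i3 : mu2.-integrable setT
   (fun z => ((e1 w - e2 w) / (2 * h ^+ k.+1) * (Kk z.1 * K1 z.2))%:E).
  under eq_fun do rewrite EFinM.
  exact: integrableZl.
split.
  under eq_fun do rewrite noisy_estE EFinD.
  exact: integrableD.
under eq_Rintegral do rewrite noisy_estE.
rewrite RintegralD// RintegralZl// e.
have K0 : \int[mu]_v K1 v = 0.
  have [_ <- _ _] := HK1; rewrite kernel_momentE; last by case: bK'.
  by apply: eq_Rintegral => v _; rewrite expr0 mul1r.
by rewrite K0 !mulr0 addr0.
Qed.

Section freeze_est.
Variables (S : set (set Omega)) (X : 'I_d -> Omega -> R) (e1 e2 U V : Omega -> R).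
Hypotheses (S_sub : <<s S >> `<=` measurable)
  (SX : forall i B, measurable B -> <<s S >> (X i @^-1` B))
  (Se1 : forall B, measurable B -> <<s S >> (e1 @^-1` B))
  (Se2 : forall B, measurable B -> <<s S >> (e2 @^-1` B))
  (ie1 : P.-integrable setT (EFin \o e1))
  (ie2 : P.-integrable setT (EFin \o e2))
  (mU : measurable_fun setT U) (mV : measurable_fun setT V)
  (law : forall A : set (R * R), measurable A ->
     P ((fun w => (U w, V w)) @^-1` A) = mu2 A)
  (indep : forall (A : set (R * R)) B, measurable A -> <<s S >> B ->
     P ((fun w => (U w, V w)) @^-1` A `&` B)
     = (P ((fun w => (U w, V w)) @^-1` A) * P B)%E)
  (Xbnd : exists M : R, {ae P, forall w, enorm (rand_vec X w) <= M}).
Local Notation Omega' := (g_sigma_algebraType S).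

Lemma measurable_noisy_est :
  measurable_fun setT (noisy_est X e1 e2 : (Omega' * (R * R))%type -> R).
Proof.
have [mKk _] := bounded_deriv_kernel HKk; have [mK1 _] := bounded_grad_kernel HK1.
have m1 : measurable_fun setT (fun p : Omega' * (R * R) => p.2.1).
  exact: (measurableT_comp measurable_fst measurable_snd).
have m2 : measurable_fun setT (fun p : Omega' * (R * R) => p.2.2).
  exact: (measurableT_comp measurable_snd measurable_snd).
have mX i : measurable_fun setT (fun p : Omega' * (R * R) => X i p.1).
  exact: (measurableT_comp (sub_measurable _ _ (SX i)) measurable_fst).
have me1 : measurable_fun setT (fun p : Omega' * (R * R) => e1 p.1).
  exact: (measurableT_comp (sub_measurable _ _ Se1) measurable_fst).
have me2 : measurable_fun setT (fun p : Omega' * (R * R) => e2 p.1).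
  exact: (measurableT_comp (sub_measurable _ _ Se2) measurable_fst).
apply: measurable_funM.
  apply: measurable_funM => //.
  by apply: measurable_funM; exact: measurableT_comp.
apply: measurable_funB.
  apply: measurable_funD => //.
  exact: (measurable_shift _ _ j l h h g _ _ _ continuous_holder mX m1 m2).
apply: measurable_funD => //.
under eq_fun do rewrite -scaleNr -mulNr.
exact: (measurable_shift _ _ j l h (- h) g _ _ _ continuous_holder mX m1 m2).
Qed.

(** Almost surely the kernel factors are bounded and the query points lie in a fixed box, on which
    the continuous [g] is bounded. The estimator is thus dominated by a constant plus a multiple of
    the integrable noises. *)
Lemma integrable_noisy_est :
  P.-integrable setT (fun w => (noisy_est X e1 e2 (w, (U w, V w)))%:E).
Proof.
have [_ [M1 M1P]] := bounded_deriv_kernel HKk.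
have [_ [M2 M2P]] := bounded_grad_kernel HK1.
have [M XM] := Xbnd.
(* Each coordinate of a query point is at most [M] from the current point plus [h] from each of the
   two displacements. *)
have [B BP] := bounded_on_box g (M + h + h) continuous_holder.
have aeUV : {ae P, forall w, half_itv R (U w) /\ half_itv R (V w)}.
  have [N [mN N0 sN]] := @ae_prod _ _ _ _ _ mu mu _ _ ae_half ae_half.
  exists ((fun w => (U w, V w)) @^-1` N); split.
  - rewrite -[X in measurable X]setTI.
    exact: (measurable_fun_pair mU mV).
  - by rewrite law.
  - by move=> w /= hw; exact: (sN (U w, V w)).
pose c := M1 * M2 / (2 * h ^+ k.+1).
have hk0 : 0 < 2 * h ^+ k.+1 by rewrite mulr_gt0// exprn_gt0.
have mest : measurable_fun setT (fun w => noisy_est X e1 e2 (w, (U w, V w))).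
  apply: (measurableT_comp measurable_noisy_est).
  apply: measurable_fun_pair; first exact: measurable_to_sub.
  exact: measurable_fun_pair.
apply: (@ae_le_integrable _ (fun w => c * (2 * B + (`|e1 w| + `|e2 w|)))) => //.
  have ib : P.-integrable setT (fun w => (2 * B + (`|e1 w| + `|e2 w|))%:E).
    have i12 := integrableD measurableT (integrable_abse ie1) (integrable_abse ie2).
    exact: (integrableD measurableT
      (finite_measure_integrable_cst P (2 * B) measurableT) i12).
  exact: (integrableZl measurableT c ib).
apply: sub_ae (filterI XM aeUV) => w [xM [hu hv]].
have box (s : R) : `|s| = h -> `|g (rand_vec X w + (h * U w) *: basis_vec R j
    + (s * V w) *: basis_vec R l)| <= B.
  move=> sh; apply: BP => i; rewrite !mxE /= ?eqxx /=.
  have lehalf (t : R) (a : bool) : half_itv R t -> `|t * a%:R| <= 1.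
    move=> /norm_half ht; rewrite normrM (@le_trans _ _ (2^-1 * 1))//.
      by rewrite ler_pM// normr_nat lern1 leq_b1.
    by rewrite mulr1 invf_le1// ler1n.
  apply: (le_trans (ler_normD _ _)); apply: lerD.
    apply: (le_trans (ler_normD _ _)); apply: lerD.
      by apply: le_trans xM; have := coord_le_enorm (rand_vec X w) i; rewrite mxE.
    by rewrite -mulrA normrM (gtr0_norm h0) ler_piMr ?(ltW h0)// lehalf.
  by rewrite -mulrA normrM sh ler_piMr ?(ltW h0)// lehalf.
rewrite /noisy_est /= normrM.
have cE : `|Kk (U w) * K1 (V w) / (2 * h ^+ k.+1)| <= c.
  rewrite normrM normfV (gtr0_norm hk0) ler_wpM2r ?invr_ge0 ?(ltW hk0)//.
  by rewrite normrM ler_pM ?M1P ?M2P.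
rewrite ler_pM//.
have g1 := box h (gtr0_norm h0).
have hN : `|- h| = h by rewrite normrN gtr0_norm.
have := box (- h) hN; rewrite mulNr scaleNr => g2.
apply: (le_trans (ler_normB _ _)).
apply: (@le_trans _ _ ((B + `|e1 w|) + (B + `|e2 w|))).
  by apply: lerD; apply: (le_trans (ler_normD _ _)); rewrite lerD2r.
by rewrite addrACA mulr2n mulrDl mul1r.
Qed.

(** The generators [S] and the noises are left general because two instances are combined later:
    point and noises together give the integral identity, the point alone with zero noises gives
    measurability of the same [Z]. *)
Lemma freeze_est : let Z w := mean_est j l k h g Kk K1 (rand_vec X w) in
  [/\ measurable_fun setT (Z : Omega' -> R), P.-integrable setT (EFin \o Z)
    & forall B, <<s S >> B -> (\int[P]_(w in B) (Z w)%:E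
       = \int[P]_(w in B) (noisy_est X e1 e2 (w, (U w, V w)))%:E)%E].
Proof.
have := @integral_freeze _ _ _ P S S_sub _ _ mu2 _ (measurable_fun_pair mU mV)
  law indep _ measurable_noisy_est integrable_noisy_est
  (fun w => (noisy_est_mean X e1 e2 w).1).
rewrite (_ : (fun w => \int[mu2]_y noisy_est X e1 e2 (w, y)) =
  fun w => mean_est j l k h g Kk K1 (rand_vec X w))//.
by apply/funext => w; rewrite (noisy_est_mean X e1 e2 w).2.
Qed.

End freeze_est.
End oracle.

(** * Law and independence of the randomization variables *)

Section directions.
Context {R : realType} {d : nat} {dO : measure_display} {Omega : measurableType dO}.
Variables (P : probability Omega R) (U V : 'I_d -> {RV P >-> R}).
Local Notation mu2 := (halfP R \x halfP R)%E.

(** Mutual independence is applied to the two-element subfamily of [U l] and [V l]; this is the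
    product formula on rectangles, which determines the joint law. *)
Lemma law_directions l :
  (forall i A, measurable A ->
     distribution P (U i) A = uniform_prob (half_lt R) A /\
     distribution P (V i) A = uniform_prob (half_lt R) A) ->
  mutually_independent P (cat_fam U V) ->
  forall A : set (R * R), measurable A ->
    P ((fun w => (U l w, V l w)) @^-1` A) = mu2 A.
Proof.
move=> lawUV indep A mA.
have mUV : measurable_fun setT
    (fun w => (U l w, V l w) : measurableTypeR R * measurableTypeR R).
  exact: (measurable_fun_pair (measurable_funPT (U l)) (measurable_funPT (V l))).
pose W : {mfun Omega >-> (measurableTypeR R * measurableTypeR R)%type} := MeasurableFun.Pack
  (MeasurableFun.Class (isMeasurableFun.Build _ _ _ _ _ mUV)).
apply/esym.
apply: (@product_measure_unique _ _ _ _ _ (halfP R) (halfP R) (distribution P W) _ A mA)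
  => A1 A2 mA1 mA2.
pose B (i : 'I_d + 'I_d) := if i is inl _ then A1 else A2.
have mB i : measurable (B i) by case: i.
have := indep [set inl l; inr l]%SET B mB.
have e1 : P (cat_fam U V (inl l) @^-1` B (inl l)) = halfP R A1.
  exact: (lawUV l A1 mA1).1.
have e2 : P (cat_fam U V (inr l) @^-1` B (inr l)) = halfP R A2.
  exact: (lawUV l A2 mA2).2.
rewrite big_setU1 ?inE// big_set1 e1 e2.
move=> <-; congr (P _); apply/seteqP; split => w /=.
  by move=> [? ?] i; rewrite /= !inE => /orP[] /eqP ->.
move=> H; split; first by apply: (H (inl l)); rewrite /= !inE eqxx.
by apply: (H (inr l)); rewrite /= !inE eqxx orbT.
Qed.

(** The pair of [U l] and [V l] is measurable for the sigma-algebra generated by all randomization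
    variables, so every event about it falls under [independent_families]. *)
Lemma indep_directions I (F : I -> Omega -> R) l :
  independent_families P (cat_fam U V) F ->
  forall (A : set (R * R)) B, measurable A -> <<s gen_of I F >> B ->
    P ((fun w => (U l w, V l w)) @^-1` A `&` B)
    = (P ((fun w => (U l w, V l w)) @^-1` A) * P B)%E.
Proof.
move=> indep A B mA FB; apply: indep => //.
pose G := gen_of _ (cat_fam U V : _ -> Omega -> R).
have mU : measurable_fun setT (U l : g_sigma_algebraType G -> R).
  by apply: sub_measurable => C mC; exact: (gen_of_preimage _ _ (inl l)).
have mV : measurable_fun setT (V l : g_sigma_algebraType G -> R).
  by apply: sub_measurable => C mC; exact: (gen_of_preimage _ _ (inr l)).
have := measurable_fun_pair mU mV.
by move=> /(_ measurableT A mA); rewrite setTI.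
Qed.

End directions.

(** * From coordinates to the gradient, and the final bounds *)

Lemma ae_forall_fin {R : realType} {dO : measure_display}
    {Omega : measurableType dO} (P : probability Omega R) (I : finType)
    (Q : I -> Omega -> Prop) :
  (forall i, {ae P, forall w, Q i w}) -> {ae P, forall w, forall i, Q i w}.
Proof. by move=> aeQ; apply: filter_forall => i; exact: aeQ. Qed.

(** The squared norm is a sum of [d] squares. The coordinate bound dominates an absolute value,
    hence is nonnegative and may be squared. *)
Lemma enorm_row_le {R : realType} {d : nat} (z : 'I_d -> R)
    (f : 'rV[R]_d -> R) (x : 'rV[R]_d) (C h b : R) :
  (forall l, `|z l - partial l f x| <= C * h `^ b) ->
  enorm ((\row_(l < d) z l) - gradient f x) ^+ 2 <= d%:R * C ^+ 2 * h `^ (2 * b).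
Proof.
move=> zf; rewrite sqr_sqrtr; last by apply: sumr_ge0 => i _; exact: sqr_ge0.
have -> : d%:R * C ^+ 2 * h `^ (2 * b) = \sum_(i < d) (C * h `^ b) ^+ 2.
  rewrite sumr_const card_ord -[RHS]mulr_natl exprMn -mulrA; congr (_ * (_ * _)).
  by rewrite mulrC powRrM powR_mulrn ?powR_ge0.
apply: ler_sum => i _; rewrite !mxE -(real_normK (num_real (_ - _))).
by rewrite lerXn2r ?nnegrE// (le_trans _ (zf i)).
Qed.

Theorem lemma5p1 (R : realType) (d : nat) (j : 'I_d) (k : nat)
    (beta L h sigma : R) (g : 'rV[R]_d -> R) (Kk K1 : R -> R)
    (dO : measure_display) (Omega : measurableType dO)
    (P : probability Omega R) (X U V epsp epsm : 'I_d -> {RV P >-> R}) :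
  1 < beta -> 0 < L -> 0 < h ->
  holder_class (beta + k%:R) L g ->
  deriv_kernel k (strict_floor (beta + k%:R)) Kk ->
  grad_kernel (strict_floor (beta + k%:R)) K1 ->
  oracle_model sigma X U V epsp epsm ->
  let f := iter k (partial j) g in
  let x_t := rand_vec X in
  let est := grad_est j k h g Kk K1 X U V epsp epsm in
  let C := C_bias L Kk K1 in
  (* random current point: E[ . | x_t] exists, and the bounds hold a.s.
     for every version of it *)
  [/\ forall l : 'I_d, exists Z, is_condexp P (sigma_of X) (est l) Z,
      forall (l : 'I_d) (Z : Omega -> R),
        is_condexp P (sigma_of X) (est l) Z ->
        {ae P, forall w,
          `|Z w - partial l f (x_t w)| <= C * h `^ (beta - 1)},
      forall Z : 'I_d -> Omega -> R,
        (forall l, is_condexp P (sigma_of X) (est l) (Z l)) ->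
        {ae P, forall w,
          enorm ((\row_(l < d) Z l w) - gradient f (x_t w)) ^+ 2
          <= d%:R * C ^+ 2 * h `^ (2 * (beta - 1))}
    & (* fixed current point: E[ . | x_t] is the expectation *)
      forall x : 'rV[R]_d, (forall w, x_t w = x) ->
        (forall l : 'I_d, P.-integrable setT (EFin \o est l) /\
          `|fine 'E_P[est l] - partial l f x| <= C * h `^ (beta - 1)) /\
        enorm ((\row_(l < d) fine 'E_P[est l]) - gradient f x) ^+ 2
        <= d%:R * C ^+ 2 * h `^ (2 * (beta - 1))].
Proof.
move=> b1 L0 h0 gH HKk HK1 [Xbnd lawUV indepUV Eeps indep] f x_t est C.
(* The candidate conditional expectation depends on [w] only through the current point. *)
pose Z l w := mean_est j l k h g Kk K1 (x_t w).
pose F := cat_fam X (cat_fam epsp epsm) : _ -> Omega -> R.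
have mF i : measurable_fun setT (F i).
  by case: i => [i|[i|i]]; exact: measurable_funPT.
have subF := sigma_of_sub _ _ mF.
have XF : <<s gen_of _ (X : _ -> Omega -> R) >> `<=` <<s gen_of _ F >>.
  by apply: gen_of_subset => i; exists (inl i).
have subX : <<s gen_of _ (X : _ -> Omega -> R) >> `<=` measurable.
  exact: subset_trans XF subF.
have indF l := indep_directions P U V _ F l indep.
have law l := law_directions P U V l lawUV indepUV.
have bias l x : `|mean_est j l k h g Kk K1 x - partial l f x| <= C * h `^ (beta - 1).
  by have [_] := mean_est_bias j l k beta L h g Kk K1 b1 L0 h0 gH HKk HK1 x.
have ie (e : {RV P >-> R}) : ('E_P[(fun w => e w ^+ 2)%R] <= (sigma ^+ 2)%R%:E)%E ->
    P.-integrable setT (EFin \o e).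
  by apply: square_integrable; exact: measurable_funPT.
have estE l : est l = fun w =>
    noisy_est j l k h g Kk K1 X (epsp l) (epsm l) (w, (U l w, V l w)) by [].
have [iest ZC] : (forall l, P.-integrable setT (EFin \o est l)) /\
    forall l, is_condexp P (sigma_of X) (est l) (Z l).
  have iestl l : P.-integrable setT (EFin \o est l).
    have [ep em] := Eeps l.
    apply: (integrable_noisy_est P j l k beta L h g Kk K1 h0 gH HKk HK1 (gen_of _ F)) => //.
    - by move=> i B mB; exact: (gen_of_preimage _ F (inl i)).
    - by move=> B mB; exact: (gen_of_preimage _ F (inr (inl l))).
    - by move=> B mB; exact: (gen_of_preimage _ F (inr (inr l))).
    - exact: ie.
    - exact: ie.
    - exact: law.
  split => // l; have [ep em] := Eeps l.
  (* First freezing, given the point and all the noises: it yields the integral identity on a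
     sigma-algebra containing that of the point. *)
  have [_ iZ intZ] : [/\ measurable_fun setT (Z l : g_sigma_algebraType (gen_of _ F) -> R),
      P.-integrable setT (EFin \o Z l)
    & forall B, <<s gen_of _ F >> B ->
      (\int[P]_(w in B) (Z l w)%:E = \int[P]_(w in B) (est l w)%:E)%E].
    apply: (freeze_est P j l k beta L h g Kk K1 b1 L0 h0 gH HKk HK1 (gen_of _ F)
      X (epsp l) (epsm l) (U l) (V l)) => //.
    - by move=> i B mB; exact: (gen_of_preimage _ F (inl i)).
    - by move=> B mB; exact: (gen_of_preimage _ F (inr (inl l))).
    - by move=> B mB; exact: (gen_of_preimage _ F (inr (inr l))).
    - exact: ie.
    - exact: ie.
    - exact: law.
    - exact: indF.
  have [mZ _ _] : [/\ measurable_fun setT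
        (Z l : g_sigma_algebraType (gen_of _ (X : _ -> Omega -> R)) -> R),
      P.-integrable setT (EFin \o Z l)
    & forall B, <<s gen_of _ (X : _ -> Omega -> R) >> B ->
      (\int[P]_(w in B) (Z l w)%:E = \int[P]_(w in B)
        (noisy_est j l k h g Kk K1 X (fun=> 0) (fun=> 0) (w, (U l w, V l w)))%:E)%E].
    apply: (freeze_est P j l k beta L h g Kk K1 b1 L0 h0 gH HKk HK1
      (gen_of _ (X : _ -> Omega -> R)) X (fun=> 0) (fun=> 0) (U l) (V l)) => //.
    - by move=> i B mB; exact: (gen_of_preimage _ (X : _ -> Omega -> R) i).
    - by move=> B mB; rewrite preimage_cst; case: ifP => _;
        [exact: (@measurableT _ (g_sigma_algebraType (gen_of _ (X : _ -> Omega -> R))))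
        |exact: (@measurable0 _ (g_sigma_algebraType (gen_of _ (X : _ -> Omega -> R))))].
    - by move=> B mB; rewrite preimage_cst; case: ifP => _;
        [exact: (@measurableT _ (g_sigma_algebraType (gen_of _ (X : _ -> Omega -> R))))
        |exact: (@measurable0 _ (g_sigma_algebraType (gen_of _ (X : _ -> Omega -> R))))].
    - exact: integrable0.
    - exact: integrable0.
    - exact: law.
    - by move=> A B mA XB; apply: indF => //; exact: XF.
  split=> //.
  - by move=> B mB; have := mZ measurableT B mB; rewrite setTI.
  - by move=> B XB; apply: intZ; exact: XF.
(* Every version agrees almost surely with [Z l], for which the bound holds at every sample
   point. *)
have condexp_bias l (Z' : Omega -> R) : is_condexp P (sigma_of X) (est l) Z' ->
    {ae P, forall w, `|Z' w - partial l f (x_t w)| <= C * h `^ (beta - 1)}.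
  move=> Z'C; have := condexp_unique _ _ subX _ _ _ Z'C (ZC l).
  by apply: sub_ae => w ->; exact: bias.
split.
- by move=> l; exists (Z l).
- exact: condexp_bias.
- move=> Z' Z'C.
  have := ae_forall_fin P _ _ (fun l => condexp_bias l _ (Z'C l)).
  by apply: sub_ae => w; exact: enorm_row_le.
- move=> x xt.
  (* At a fixed point [Z l] is constant, so the defining identity of the conditional expectation
     over the whole space computes the expectation. *)
  have EZ l : fine 'E_P[est l] = mean_est j l k h g Kk K1 x.
    rewrite unlock; have [_ _ _ <-] := ZC l.
      under eq_integral do rewrite /Z xt.
      rewrite integral_cst//.
      apply: etrans (congr1 (fun t => fine (_ * t)%E) (probability_setT P)) _.
      by rewrite mule1.
    exact: (@measurableT _ (g_sigma_algebraType (gen_of _ (X : _ -> Omega -> R)))).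
  split=> [l|]; first by split => //; rewrite EZ.
  by apply: enorm_row_le => l; rewrite EZ.
Qed.
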